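(* Let $p$ be a positive integer and let $\pi(\kappa)=\kappa^{a-1}(1-\kappa)^{b-1}h(\kappa)$, $\kappa\in(0,1)$, where $a<1$, $0<b<1$, and $h:(0,1]\to(0,\infty)$ is continuously differentiable, slowly varying at $\kappa=0$, and satisfies $\lim_{\kappa\to0}\kappa h'(\kappa)/h(\kappa)=0$. Assume that either $a>-p/2$, or $a=-p/2$ and $\int_0^1\kappa^{-1}h(\kappa)\,\mathrm{d}\kappa<\infty$. Set $$H(\kappa)=\kappa\frac{h'(\kappa)}{h(\kappa)}\ (0<\kappa\le 1),\quad H(0)=0,\qquad H_1(\kappa)=\inf_{0\le t\le\kappa}H(t),\qquad H_2(\kappa)=H(\kappa)-H_1(\kappa).$$ Suppose $-p/2\le a<p/2-2$. If $$\frac{3p}{2}+a-\frac{p+2a+2+2\max_{\kappa\in[0,1]}H_2(\kappa)}{b}+\min\left\{0,\ \frac p2+a+2+H_1(1)\right\}\ge 0,$$ then the (generalized) Bayes estimator of $\beta$ with respect to the prior $\pi(\kappa)$ is minimax for estimating $\beta$ from $y\sim N_p(\beta,I_p)$ under quadratic loss $\|\hat\beta-\beta\|^2$.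
   Context: Model: $y\mid\beta\sim N_p(\beta,I_p)$, $\beta\mid\kappa\sim N_p(0,\kappa^{-1}(1-\kappa)I_p)$, $\kappa\sim\pi(\kappa)$ on $(0,1)$, where $\pi(\kappa)$ may be improper. The (generalized) Bayes estimator with respect to $\pi$ is $$\hat\beta(y)=\left(1-\frac{\int_0^1\kappa^{p/2+1}\exp(-\kappa\|y\|^2/2)\pi(\kappa)\,\mathrm{d}\kappa}{\int_0^1\kappa^{p/2}\exp(-\kappa\|y\|^2/2)\pi(\kappa)\,\mathrm{d}\kappa}\right)y .$$ The risk of an estimator $\delta$ is $E_\beta\|\delta(Y)-\beta\|^2$ with $Y\sim N_p(\beta,I_p)$. An estimator is minimax if it minimizes the supremum over $\beta\in\mathbb{R}^p$ of the risk among all estimators; the minimax value is $p$, so $\delta$ is minimax if and only if $E_\beta\|\delta(Y)-\beta\|^2\le p$ for all $\beta\in\mathbb{R}^p$. A function $h>0$ is slowly varying at $0$ if $\lim_{\kappa\to0}h(t\kappa)/h(\kappa)=1$ for every $t>0$. *)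

(* Defs.v *)
From HB Require Import structures.
From mathcomp Require Import all_boot all_order all_algebra.
From mathcomp Require Import all_classical all_reals all_analysis.

Set Implicit Arguments.
Unset Strict Implicit.
Unset Printing Implicit Defensive.
Import Order.TTheory GRing.Theory Num.Theory.
Import numFieldNormedType.Exports.
Local Open Scope classical_set_scope.
Local Open Scope ring_scope.

Section product_law.
Context {d : measure_display} {T : measurableType d} {R : realType}.

Definition cons_pair n (x : T * n.-tuple T) : n.+1.-tuple T :=
  [the n.+1.-tuple T of x.1 :: x.2].

Lemma measurable_cons_pair n : measurable_fun setT (@cons_pair n).
Proof. exact: measurable_cons. Qed.

HB.instance Definition _ n :=
  isMeasurableFun.Build _ _ _ _ (@cons_pair n) (@measurable_cons_pair n).

(* The law of a vector with independent coordinates of laws P 0, ..., P (n-1);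
   [prod_prob_box] is its characterization on boxes. *)
Fixpoint prod_prob n : ('I_n -> probability T R) -> probability (n.-tuple T) R :=
  match n with
  | 0 => fun _ => \d_([tuple] : 0.-tuple T)
  | m.+1 => fun P =>
      distribution (P ord0 \x prod_prob (fun i => P (lift ord0 i)))%E
        (@cons_pair m)
  end.

Lemma measurable_box n (A : 'I_n -> set T) : (forall i, measurable (A i)) ->
  measurable [set y : n.-tuple T | forall i, A i (tnth y i)].
Proof.
move=> mA.
rewrite (_ : [set _ | _] = \bigcap_(i in [set: 'I_n])
    ((fun y : n.-tuple T => tnth y i) @^-1` A i)); last first.
  apply/seteqP; split=> y /= Ay i; first by move=> _; exact: Ay.
  exact: (Ay i Logic.I).
apply: fin_bigcap_measurable => // i _.
by rewrite -[X in measurable X]setTI; apply: measurable_tnth => //; exact: mA.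
Qed.

Lemma prod_prob_box n (P : 'I_n -> probability T R) (A : 'I_n -> set T) :
  (forall i, measurable (A i)) ->
  prod_prob P [set y | forall i, A i (tnth y i)] = (\prod_(i < n) P i (A i))%E.
Proof.
elim: n P A => [|n IHn] P A mA /=.
  by rewrite big_ord0 diracE mem_set// => -[].
rewrite big_ord_recl -IHn//.
rewrite -product_measure1E//; last first.
  by apply: (measurable_box (A := fun i => A (lift ord0 i))) => i; exact: mA.
rewrite /distribution /pushforward; congr (product_measure1 _ _ _).
apply/seteqP; split=> [[x y]/= Axy|[x y]/= [Ax Ay] i].
  split; first by have := Axy ord0; rewrite tnth0.
  by move=> i; have := Axy (lift ord0 i); rewrite tnthS.
case: (unliftP ord0 i) => [j|] ->; last by rewrite tnth0.
by rewrite tnthS.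
Qed.

End product_law.

(* R^n with its Borel sigma-algebra, as the n-fold product of the library's
   Borel line [measurableTypeR R] (convertible to R); matrix-based vectors
   would come with the sup norm. *)
Notation vec R n := (n.-tuple (measurableTypeR R)).

Section decision_theory.
Context {R : realType}.

Definition sqnorm n (y : vec R n) : R := \sum_(i < n) (tnth y i : R) ^+ 2.

Definition sqdist n (x y : vec R n) : R :=
  \sum_(i < n) ((tnth x i : R) - (tnth y i : R)) ^+ 2.

(* N_p(beta, I_p); the second parameter of [normal_prob] is the standard
   deviation. *)
Definition gaussian p (beta : vec R p) : probability (vec R p) R :=
  prod_prob (fun i => normal_prob (tnth beta i) 1).

Definition risk p (delta : vec R p -> vec R p) (beta : vec R p) : \bar R :=
  (\int[gaussian beta]_y (sqdist (delta y) beta)%:E)%E.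

Definition sup_risk p (delta : vec R p -> vec R p) : \bar R :=
  ereal_sup [set risk delta beta | beta in setT].

Definition minimax p (delta : vec R p -> vec R p) : Prop :=
  measurable_fun setT delta /\
  forall delta' : vec R p -> vec R p, measurable_fun setT delta' ->
    (sup_risk delta <= sup_risk delta')%E.

Definition kappa_moment (prior : R -> R) (q s : R) : R :=
  \int[lebesgue_measure]_(k in `]0, 1[)
    (k `^ q * expR (- (k * s / 2)) * prior k).

Definition bayes_estimator p (prior : R -> R) (y : vec R p) : vec R p :=
  let s := sqnorm y in
  let w := 1 - kappa_moment prior (p%:R / 2 + 1) s
               / kappa_moment prior (p%:R / 2) s in
  [tuple w * (tnth y i : R) | i < p].

End decision_theory.

Section prior.
Context {R : realType}.

(* f' is the derivative of f on A computed inside A: two-sided at interior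
   points, one-sided at endpoints belonging to A. *)
Definition C1_on (A : set R) (f f' : R -> R) : Prop :=
  (forall x, A x ->
     (f t - f x) / (t - x) @[t --> within A x^'] --> f' x) /\
  {within A, continuous f'}.

Definition slowly_varying0 (h : R -> R) : Prop :=
  forall t, 0 < t -> h (t * k) / h k @[k --> 0^'+] --> (1 : R).

Definition prior_density (a b : R) (h : R -> R) (k : R) : R :=
  k `^ (a - 1) * (1 - k) `^ (b - 1) * h k.

Definition H_fun (h h' : R -> R) (k : R) : R :=
  if k == 0 then 0 else k * (h' k / h k).

Definition H1_fun (h h' : R -> R) (k : R) : R :=
  inf [set H_fun h h' t | t in `[0, k]].

Definition H2_fun (h h' : R -> R) (k : R) : R :=
  H_fun h h' k - H1_fun h h' k.

(* Under the hypotheses on h, H and hence H1 and H2 are continuous on [0, 1],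
   so this supremum is attained. *)
Definition max_H2 (h h' : R -> R) : R :=
  sup [set H2_fun h h' k | k in `[0, 1]].

End prior.

(* Main.v *)
(* With [s = ||y||^2], the estimator is [(1 - r(s)) y], where [r] is a ratio of
   exponential moments of the weight
   [phi(k) = k^(c-1) (1-k)^(b-1) h(k)], [c = p/2 + a >= 0].  Stein's identity bounds
   its risk by [p] as soon as [s r^2 - 2 p r - 4 s r' <= 0], that is, with
   [w = s/2] and [M_j] the integral of [k^j exp(-w k) phi(k)],
   [2 w M_2/M_1 - w M_1/M_0 <= p].  Integrating by parts against
   [q(k) = exp(-w k) - exp(-w)], which vanishes at [k = 1] and thereby absorbs the
   singularity of [(1-k)^(b-1)], bounds [w M_2] from above and [w M_1] from below by
   integrals against the measure [q(k) phi(k) dk].  There [H = H_1 + H_2] with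
   [H_1] nonincreasing, so Chebyshev's correlation inequality handles [H_1], [H_2]
   is at most its maximum, and the claim becomes the hypothesis on [p, a, b].

   Conversely every estimator has maximal risk at least [p]: it is at least the Bayes
   risk [p V] for the normal prior of variance [V/(1-V)], and [V] tends to [1]. *)
Require Import Defs.
From HB Require Import structures.
From mathcomp Require Import all_boot all_order all_algebra.
From mathcomp Require Import all_classical all_reals all_analysis.
From mathcomp Require Import measurable_realfun ring lra.
Set Implicit Arguments.
Unset Strict Implicit.
Unset Printing Implicit Defensive.
Import Order.TTheory GRing.Theory Num.Theory.
Import numFieldNormedType.Exports.
Local Open Scope classical_set_scope.
Local Open Scope ring_scope.

(** * Integration over finite products *)

(** The singularity of the weight at 1 and the case c = 0 shape the integrations by parts. The
    logarithmic derivative of phi contains (1-b)/(1-k). Writing q = E e with e = exp(-w k) and E = 1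
    - exp(-w (1-k)), this term only ever meets E, and T = E/(1-k) lies between 0 and w. In the
    identity for w M_2 the bound T <= w leaves w M_2 - (1-b) w M_2 = b w M_2, which is the origin of
    the division by b; in the one for w M_1 the bound T >= 0 suffices. For c = 0 the boundary term k
    phi(k) is of order h(k) at 0, so the relation for w M_1 is kept as an inequality, through the
    sign of that term.

    Stein's identity is applied to one coordinate with the others frozen, and only nonnegative
    integrands are compared, so Tonelli's theorem suffices in dimension p. The growth bounds needed
    in the free coordinate come from 0 <= r <= 1 and -1 <= r' <= 0; the latter holds because r' is
    minus half the variance of a variable with values in [0, 1]. *)

Section product_integral.
Context {d : measure_display} {T : measurableType d} {R : realType}.

Lemma ge0_integral_prod_prob n (P : 'I_n.+1 -> probability T R)
    (f : n.+1.-tuple T -> \bar R) :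
  measurable_fun setT f -> (forall y, (0 <= f y)%E) ->
  (\int[prod_prob P]_y f y =
   \int[P ord0]_x \int[prod_prob (fun i => P (lift ord0 i))]_y
     f (cons_pair (x, y)))%E.
Proof.
move=> mf f0 /=; rewrite ge0_integral_pushforward//=.
by rewrite fubini_tonelli1//=; exact: measurableT_comp.
Qed.

Definition tupdate n (y : n.-tuple T) (i : 'I_n) (x : T) : n.-tuple T :=
  [tuple if j == i then x else tnth y j | j < n].

Lemma tnth_tupdate n (y : n.-tuple T) i x j :
  tnth (tupdate y i x) j = if j == i then x else tnth y j.
Proof. by rewrite tnth_mktuple. Qed.

Lemma tupdate_cons0 n (y : n.-tuple T) x0 x :
  tupdate (cons_pair (x0, y)) ord0 x = cons_pair (x, y).
Proof.
apply: eq_from_tnth => j; rewrite tnth_tupdate.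
by case: (unliftP ord0 j) => [k|] ->; rewrite ?eqxx ?tnth0// !tnthS.
Qed.

Lemma tupdate_consS n (y : n.-tuple T) i x0 x :
  tupdate (cons_pair (x0, y)) (lift ord0 i) x = cons_pair (x0, tupdate y i x).
Proof.
apply: eq_from_tnth => j; rewrite tnth_tupdate.
case: (unliftP ord0 j) => [k|] ->; last by rewrite !tnth0.
by rewrite !tnthS tnth_tupdate (inj_eq lift_inj).
Qed.

Lemma measurable_cons_pairr n (x : T) :
  measurable_fun setT (fun y : n.-tuple T => cons_pair (x, y)).
Proof.
apply/measurable_fun_tnthP => j.
case: (unliftP ord0 j) => [k|] ->.
  rewrite (_ : _ \o _ = fun y => tnth y k); first exact: measurable_tnth.
  by apply/funext => y /=; rewrite tnthS.
rewrite (_ : _ \o _ = cst x); first exact: measurable_cst.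
by apply/funext => y /=; rewrite tnth0.
Qed.

Lemma measurable_section_cons n (f : n.+1.-tuple T -> \bar R) (x : T) :
  measurable_fun setT f -> measurable_fun setT (fun y => f (cons_pair (x, y))).
Proof. by move=> mf; exact: (measurableT_comp mf (measurable_cons_pairr x)). Qed.

(** This carries one-dimensional inequalities over to dimension n: both the risk bound and the Bayes
    lower bound are proved on lines parallel to one axis. Induction on n brings coordinate i to the
    front. *)
Lemma le_integral_sections n (P : 'I_n -> probability T R) (i : 'I_n)
    (f g : n.-tuple T -> \bar R) :
  measurable_fun setT f -> measurable_fun setT g ->
  (forall y, (0 <= f y)%E) -> (forall y, (0 <= g y)%E) ->
  (forall y, (\int[P i]_x f (tupdate y i x) <= \int[P i]_x g (tupdate y i x))%E) ->
  (\int[prod_prob P]_y f y <= \int[prod_prob P]_y g y)%E.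
Proof.
elim: n P i f g => [|n IHn] P i f g; first by case: i.
move=> mf mg f0 g0 fg; rewrite !ge0_integral_prod_prob//.
have mF (u : n.+1.-tuple T -> \bar R) : measurable_fun setT u ->
    measurable_fun setT (u \o @cons_pair _ T n).
  by move=> mu; apply: measurableT_comp => //; exact: measurable_cons_pair.
(* If i is the first coordinate, Tonelli makes its integral the inner one; otherwise the first
   coordinate is frozen and the induction hypothesis applies. *)
case: (unliftP ord0 i) => [j|] ij; last first.
  rewrite ij in fg.
  rewrite (fubini_tonelli (f \o @cons_pair _ T n))//=; last exact: mF.
  rewrite (fubini_tonelli (g \o @cons_pair _ T n))//=; last exact: mF.
  apply: ge0_le_integral => //=.
  - by move=> y _; exact: integral_ge0.
  - exact: (@measurable_fun_fubini_tonelli_G _ _ _ _ R (P ord0)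
      _ (mF _ mf) (fun=> f0 _)).
    - exact: (@measurable_fun_fubini_tonelli_G _ _ _ _ R (P ord0)
      _ (mF _ mg) (fun=> g0 _)).
  (* The value [point] is a placeholder that the update overwrites. *)
  move=> y _; have := fg (cons_pair (point, y)).
  by under eq_integral do rewrite tupdate_cons0;
     under [in leRHS]eq_integral do rewrite tupdate_cons0.
apply: ge0_le_integral => //=.
- by move=> y _; exact: integral_ge0.
- exact: (@measurable_fun_fubini_tonelli_F _ _ _ _ R (prod_prob (fun k => P (lift ord0 k)))
      _ (mF _ mf) (fun=> f0 _)).
- exact: (@measurable_fun_fubini_tonelli_F _ _ _ _ R (prod_prob (fun k => P (lift ord0 k)))
      _ (mF _ mg) (fun=> g0 _)).
move=> x _; apply: (IHn _ j) => //; try exact: measurable_section_cons.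
move=> y; have := fg (cons_pair (x, y)); rewrite ij.
by under eq_integral do rewrite tupdate_consS;
     under [in leRHS]eq_integral do rewrite tupdate_consS.
Qed.

End product_integral.

(** * Calculus and Stein's identity *)

Section calculus.
Context {R : realType}.
Local Notation mu := (@lebesgue_measure R).
Implicit Types (f F : R -> R) (D : set R) (x y : R^nat).

Lemma is_derive_continuous F (t l : R) : is_derive t 1 F l -> {for t, continuous F}.
Proof.
move=> dF; apply: differentiable_continuous; apply/derivable1_diffP.
exact: ex_derive.
Qed.

Lemma is_derive_mulfun f F (t a b : R) :
  is_derive t 1 f a -> is_derive t 1 F b ->
  is_derive t 1 (fun u => f u * F u) (a * F t + f t * b).
Proof.
move=> df dF; rewrite addrC mulrC (mulrC a) -[b * _]mulrC.
exact: is_deriveM.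
Qed.

Lemma is_derive_addfun f F (t a b : R) :
  is_derive t 1 f a -> is_derive t 1 F b ->
  is_derive t 1 (fun u => f u + F u) (a + b).
Proof. by move=> df dF; exact: is_deriveD. Qed.

Lemma is_derive_oppfun f (t a : R) :
  is_derive t 1 f a -> is_derive t 1 (fun u => - f u) (- a).
Proof. by move=> df; exact: is_deriveN. Qed.

Lemma is_derive_mulcst (k : R) f (t a : R) :
  is_derive t 1 f a -> is_derive t 1 (fun u => k * f u) (k * a).
Proof. by move=> df; exact: is_deriveZ. Qed.

Lemma is_derive_expRfun f (t a : R) :
  is_derive t 1 f a -> is_derive t 1 (fun u => expR (f u)) (expR (f t) * a).
Proof. by move=> df; exact: is_derive1_comp. Qed.

Lemma integral_is_derive F f (a b : R) : a < b ->
  (forall t, a <= t <= b -> is_derive t 1 F (f t)) ->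
  (forall t, a <= t <= b -> {for t, continuous f}) ->
  (\int[mu]_(t in `[a, b]) (f t)%:E = (F b - F a)%:E)%E.
Proof.
move=> ab dF cf; rewrite (@continuous_FTC2 _ f F a b ab) ?EFinB//.
- apply: continuous_in_subspaceT => t; rewrite inE/= in_itv/= => tab.
  exact: cf.
- split=> [t||].
  + rewrite in_itv/= => /andP[/ltW at_ /ltW tb].
    by have dFt := dF t; apply: ex_derive; apply: dFt; rewrite at_ tb.
  + apply: cvg_at_right_filter; apply: (@is_derive_continuous _ _ (f a)).
    by apply: dF; rewrite lexx ltW.
  + apply: cvg_at_left_filter; apply: (@is_derive_continuous _ _ (f b)).
    by apply: dF; rewrite lexx ltW.
- move=> t; rewrite in_itv/= => /andP[/ltW at_ /ltW tb].
  have dFt : is_derive t 1 F (f t) by apply: dF; rewrite at_ tb.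
  by rewrite derive1E derive_val.
Qed.

(** Compact intervals increasing to D: the fundamental theorem of calculus holds on each of them,
    and one passage to the limit serves both the real line (Stein) and ]0, 1[ (integration by
    parts). *)
Definition exhausts D x y :=
  [/\ nonincreasing_seq x, nondecreasing_seq y, (forall n, x n < y n) &
      D = \bigcup_n `[x n, y n]%classic].

Lemma exhausts_measurable D x y : exhausts D x y -> measurable D.
Proof. by case=> _ _ _ ->; exact: bigcup_measurable. Qed.

Lemma exhausts_sub D x y n t : exhausts D x y -> x n <= t <= y n -> D t.
Proof. by case=> _ _ _ -> xty; exists n => //=; rewrite in_itv. Qed.

Lemma exhausts_homo D x y : exhausts D x y ->
  {homo (fun n => `[x n, y n]%classic) : n m / (n <= m)%N >-> (n <= m)%O}.
Proof.
case=> dx ny _ _ n m nm; apply/subsetPset; apply: subset_itv; rewrite bnd_simp.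
  exact: dx.
exact: ny.
Qed.

(** Monotone convergence; it is the source of integrability for functions with a bounded
    primitive. *)
Lemma ge0_integral_exhausts_le D x y F f (K : R) : exhausts D x y ->
  measurable_fun D f -> (forall t, D t -> 0 <= f t) ->
  (forall t, D t -> is_derive t 1 F (f t)) ->
  (forall t, D t -> {for t, continuous f}) ->
  (forall n, F (y n) - F (x n) <= K) ->
  (\int[mu]_(t in D) (f t)%:E <= K%:E)%E.
Proof.
move=> exD mf f0 dF cf FK; have [_ _ xy DE] := exD.
have mfn n : measurable_fun `[x n, y n] (EFin \o f).
  apply/measurable_EFinP; apply: measurable_funS mf.
    exact: exhausts_measurable exD.
  by move=> t /=; rewrite in_itv/=; exact: exhausts_sub.
have f0n n t : `[x n, y n]%classic t -> (0 <= (EFin \o f) t)%E.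
  by rewrite /= in_itv/= lee_fin => /(exhausts_sub exD); exact: f0.
have cvgf : (\int[mu]_(t in `[x n, y n]) (f t)%:E)%E @[n --> \oo] -->
    (\int[mu]_(t in D) (f t)%:E)%E.
  rewrite DE; exact: (@ge0_nondecreasing_set_cvg_integral _ (measurableTypeR R) R
    _ (EFin \o f) mu (exhausts_homo exD) (fun n => measurable_itv _) mfn f0n).
rewrite -(cvg_lim _ cvgf)//; apply: lime_le; first by apply/cvg_ex; eexists; exact: cvgf.
apply: nearW => n; rewrite (integral_is_derive (xy n)
  (fun t xty => dF t (exhausts_sub exD xty))
  (fun t xty => cf t (exhausts_sub exD xty))).
by rewrite lee_fin.
Qed.

(** Dominated convergence with |f| as the bound. Boundary terms thus become limits along the two
    sequences of end points. *)
Lemma cvg_integral_exhausts D x y F f : exhausts D x y ->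
  mu.-integrable D (EFin \o f) ->
  (forall t, D t -> is_derive t 1 F (f t)) ->
  (forall t, D t -> {for t, continuous f}) ->
  F (y n) - F (x n) @[n --> \oo] --> (\int[mu]_(t in D) f t)%R.
Proof.
move=> exD intf dF cf; have [dx ny xy DE] := exD.
have mD := exhausts_measurable exD.
pose g n := (EFin \o f) \_ `[x n, y n].
have gE n : (\int[mu]_(t in D) g n t = (F (y n) - F (x n))%:E)%E.
  rewrite -integral_mkcondr setIidr; last first.
    by move=> t /=; rewrite in_itv/=; exact: exhausts_sub.
  by apply: integral_is_derive => // t /(exhausts_sub exD); [exact: dF|exact: cf].
suff : (\int[mu]_(t in D) g n t)%E @[n --> \oo] --> (\int[mu]_(t in D) (f t)%:E)%E.
  under eq_fun do rewrite gE.
  rewrite -[X in _ --> X -> _]fineK; last first.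
    by apply: integrable_fin_num.
  exact: (fine_cvg (f := fun n => (F (y n) - F (x n))%:E)).
apply: (@dominated_cvg _ _ _ mu D mD g _ (fun t => `|f t|%:E)).
- move=> n; apply/measurable_restrict => //.
  by apply: measurable_funS (measurable_int _ intf) => //; exact: subIsetl.
- move=> t; rewrite {1}DE => -[N _ /=]; rewrite in_itv/= => /andP[xt ty].
  apply: cvg_near_cst; exists N => // n /= Nn.
  rewrite /g patchE mem_set//= in_itv/= (le_trans (dx _ _ Nn) xt)/=.
  exact: le_trans (ny _ _ Nn).
- by [].
- by have := integrable_abse intf.
- move=> n t Dt; rewrite /g patchE; case: ifPn => _ //=.
  by rewrite normr0 lee_fin.
Qed.

Lemma natS_unbounded (t : R) : exists n : nat, t <= n.+1%:R.
Proof.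
exists (Num.truncn `|t|); apply: (le_trans (ler_norm t)).
by rewrite ltW// truncnS_gt.
Qed.

Lemma exhausts_setT : exhausts [set: R] (fun n => - n.+1%:R) (fun n => n.+1%:R).
Proof.
split.
- by move=> n m nm; rewrite lerN2 ler_nat ltnS.
- by move=> n m nm; rewrite ler_nat ltnS.
- by move=> n; apply: (@lt_trans _ _ 0); rewrite ?oppr_lt0 ltr0n.
- apply/seteqP; split=> // t _; have [n tn] := natS_unbounded `|t|.
  by exists n => //=; rewrite in_itv/= -ler_norml.
Qed.

(** The offset 3 keeps the end points strictly ordered already at n = 0, where 1/3 < 1 - 1/3. *)
Lemma exhausts_01 : exhausts `]0%R, 1%R[%classic
  (fun n => n.+3%:R^-1 : R) (fun n => 1 - n.+3%:R^-1).
Proof.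
have n0 n : 0 < n.+3%:R^-1 :> R by rewrite invr_gt0 ltr0n.
have dn n m : (n <= m)%N -> m.+3%:R^-1 <= n.+3%:R^-1 :> R.
  by move=> nm; rewrite lef_pV2 ?posrE ?ltr0n// ler_nat.
split.
- exact: dn.
- by move=> n m nm; rewrite lerD2l lerN2 dn.
- move=> n; have := dn 0%N n (leq0n _).
  have : 3^-1 < 2^-1 :> R by rewrite ltf_pV2 ?posrE ?ltr0n// ltr_nat.
  by move: (n.+3%:R^-1) => u; lra.
- apply/seteqP; split=> [t /=|t [n _ /=]].
  + rewrite in_itv/= => /andP[t0 t1].
    (* One n that exceeds the reciprocals of both distances to the boundary. *)
    have [n tn] := natS_unbounded (t^-1 + (1 - t)^-1).
    have it0 : 0 < t^-1 by rewrite invr_gt0.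
    have it1 : 0 < (1 - t)^-1 by rewrite invr_gt0 subr_gt0.
    have nn3 : n.+1%:R <= n.+3%:R :> R by rewrite ler_nat; do 2 apply: leqW.
    exists n => //=; rewrite in_itv/=; apply/andP; split.
      rewrite -[leRHS]invrK lef_pV2 ?posrE ?ltr0n//.
      by apply: le_trans nn3; apply: le_trans tn; rewrite lerDl ltW.
    rewrite lerBrDr -lerBrDl -[leRHS]invrK lef_pV2 ?posrE ?ltr0n//.
    by apply: le_trans nn3; apply: le_trans tn; rewrite lerDr ltW.
  + rewrite !in_itv/= => /andP[nt tn]; rewrite (lt_le_trans (n0 n) nt)/=.
    by apply: (le_lt_trans tn); rewrite gtrBl.
Qed.

End calculus.

(** * One-dimensional normal laws and Stein's identity *)

Section normal.
Context {R : realType}.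
Local Notation mu := (@lebesgue_measure R).

(** The Radon-Nikodym derivative and the explicit density integrate to the same value over every
    measurable set, hence agree almost everywhere. *)
Lemma ge0_integral_normal_prob (m s : R) (f : R -> \bar R) :
  measurable_fun setT f -> (forall x, (0 <= f x)%E) ->
  (\int[normal_prob m s]_x f x = \int[mu]_x (f x * (normal_pdf m s x)%:E))%E.
Proof.
move=> mf f0; have dom := normal_prob_dominates m s.
rewrite -(Radon_Nikodym_SigmaFinite.change_of_variables dom)//.
apply: ae_eq_integral => //.
- apply: emeasurable_funM => //.
  exact: measurable_int (Radon_Nikodym_SigmaFinite.f_integrable dom).
- apply: emeasurable_funM => //; apply/measurable_EFinP.
  exact: measurable_normal_pdf.
- apply: ae_eqe_mul2l; apply: integral_ae_eq => //.
  + exact: Radon_Nikodym_SigmaFinite.f_integrable dom.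
  + by apply/measurable_EFinP; exact: measurable_normal_pdf.
  + by move=> A _ mA; rewrite -Radon_Nikodym_SigmaFinite.f_integral.
Qed.

Lemma normal_pdf_expR (m s x : R) : s != 0 ->
  normal_pdf m s x = normal_peak s * expR (- ((x - m) ^+ 2 / (2 * s ^+ 2))).
Proof.
by move=> s0; rewrite normal_pdfE// /normal_fun mulNr -[s ^+ 2 *+ 2]mulr_natl.
Qed.

Lemma is_derive_normal_pdf (m s x : R) : s != 0 ->
  is_derive x 1 (normal_pdf m s) (- ((x - m) / s ^+ 2 * normal_pdf m s x)).
Proof.
move=> s0; rewrite (_ : normal_pdf m s = fun x => normal_peak s *
  expR (- (2 * s ^+ 2)^-1 * ((x - m) * (x - m)))); last first.
  apply/funext => t; rewrite normal_pdf_expR//; congr (_ * expR _).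
  by rewrite mulNr mulrC expr2.
have dxm : is_derive x 1 (fun t => t - m) 1.
  by rewrite -[1 in X in is_derive _ _ _ X]subr0; apply: is_deriveB.
have := is_derive_mulcst (normal_peak s) (is_derive_expRfun
  (is_derive_mulcst (- (2 * s ^+ 2)^-1) (is_derive_mulfun dxm dxm))).
by move/is_derive_eq; apply; field.
Qed.

(* With [u = (x-m)^2/(4s^2)] this is [u exp(-2u) <= exp(-u)]. *)
Lemma normal_pdf_quadratic_le (m s x : R) : s != 0 ->
  (1 + (x - m) ^+ 2) * normal_pdf m s x <=
  (1 + 4 * s ^+ 2) * normal_peak s / normal_peak (Num.sqrt 2 * s) *
    normal_pdf m (Num.sqrt 2 * s) x.
Proof.
move=> s0; have r0 : Num.sqrt 2 * s != 0 by rewrite mulf_neq0// sqrtr_eq0 -ltNge.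
have p0 := normal_peak_gt0 r0; have q0 := normal_peak_gt0 s0.
rewrite !normal_pdf_expR// exprMn sqr_sqrtr//.
set u := (x - m) ^+ 2 / (2 * (2 * s ^+ 2)).
have u0 : 0 <= u by rewrite divr_ge0 ?sqr_ge0//; have := sqr_ge0 s; lra.
have -> : (x - m) ^+ 2 = 4 * s ^+ 2 * u by rewrite /u; field.
have -> : 4 * s ^+ 2 * u / (2 * s ^+ 2) = u + u by field.
have -> : (1 + 4 * s ^+ 2) * normal_peak s / normal_peak (Num.sqrt 2 * s) *
  (normal_peak (Num.sqrt 2 * s) * expR (- u)) =
  (1 + 4 * s ^+ 2) * (normal_peak s * expR (- u)) by field; rewrite gt_eqF.
rewrite opprD expRD [leLHS](_ : _ = (1 + 4 * s ^+ 2 * u) * expR (- u) *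
  (normal_peak s * expR (- u))); last by ring.
apply: ler_wpM2r; first by rewrite mulr_ge0 ?expR_ge0 ?ltW.
have e1 : expR (- u) <= 1 by rewrite -expR0 ler_expR oppr_le0.
have e2 : u * expR (- u) <= 1.
  rewrite expRN ler_pdivrMr ?expR_gt0// mul1r.
  by apply: le_trans (expR_ge1Dx u); rewrite lerDr.
rewrite mulrDl mul1r; apply: lerD => //.
by rewrite -mulrA ler_piMr// mulr_ge0// sqr_ge0.
Qed.

(** Quadratic growth is absorbed by doubling the variance, which leaves a multiple of an integrable
    density. *)
Lemma integrable_normal_pdf_quadratic (m s A : R) (f : R -> R) : s != 0 ->
  measurable_fun setT f -> (forall x, `|f x| <= A * (1 + (x - m) ^+ 2)) ->
  mu.-integrable setT (EFin \o (fun x => f x * normal_pdf m s x)).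
Proof.
move=> s0 mf fA.
set K := (1 + 4 * s ^+ 2) * normal_peak s / normal_peak (Num.sqrt 2 * s).
have A0 : 0 <= A.
  by have := le_trans (normr_ge0 _) (fA m); rewrite subrr expr0n addr0 mulr1.
apply: (@le_integrable _ _ _ mu _ measurableT _
  (EFin \o (fun x => A * K * normal_pdf m (Num.sqrt 2 * s) x))).
- apply/measurable_EFinP; apply: measurable_funM => //.
  exact: measurable_normal_pdf.
- move=> x _; rewrite /= lee_fin [leRHS]ger0_norm; last first.
    rewrite !mulr_ge0 ?normal_pdf_ge0 ?invr_ge0 ?normal_peak_ge0//.
    by have := sqr_ge0 s; lra.
  rewrite normrM (ger0_norm (normal_pdf_ge0 _ _ _)).
  apply: (le_trans (ler_wpM2r (normal_pdf_ge0 m s x) (fA x))).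
  rewrite -[leLHS]mulrA -[leRHS]mulrA ler_wpM2l//.
  exact: normal_pdf_quadratic_le.
- exact: (integrableZl measurableT (A * K) (integrable_normal_pdf m _)).
Qed.

Lemma linear_growth_normal_pdf_cvg0 (m s A : R) (g : R -> R) (z : R^nat) :
  s != 0 -> (forall x, `|g x| <= A * (1 + `|x - m|)) ->
  (forall n, `|z n| = n.+1%:R) ->
  g (z n) * normal_pdf m s (z n) @[n --> \oo] --> 0.
Proof.
move=> s0 gA zn; have r0 : Num.sqrt 2 * s != 0.
  by rewrite mulf_neq0// sqrtr_eq0 -ltNge.
have [K K0 phiK] : exists2 K : R, 0 <= K &
    forall x, (1 + (x - m) ^+ 2) * normal_pdf m s x <= K.
  exists ((1 + 4 * s ^+ 2) * normal_peak s / normal_peak (Num.sqrt 2 * s) *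
    normal_peak (Num.sqrt 2 * s)).
    rewrite !mulr_ge0 ?invr_ge0 ?normal_peak_ge0//.
    by have := sqr_ge0 s; lra.
  move=> x; apply: (le_trans (normal_pdf_quadratic_le m x s0)).
  apply: ler_wpM2l; last exact: normal_pdf_ub.
  rewrite !mulr_ge0 ?invr_ge0 ?normal_peak_ge0//.
  by have := sqr_ge0 s; lra.
have A0 : 0 <= A.
  have := le_trans (normr_ge0 _) (gA m).
  by rewrite subrr normr0 addr0 mulr1.
(* With v = |z n - m|: n + 1 <= (1 + v)(1 + |m|) and (1 + v)^2 <= 2 (1 + v^2), and (1 + v^2) times
   the density is at most K. *)
pose C := A * (2 * K * (1 + `|m|)).
have gz n : `|g (z n) * normal_pdf m s (z n)| <= C * harmonic n.
  rewrite normrM (ger0_norm (normal_pdf_ge0 _ _ _)).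
  apply: (le_trans (ler_wpM2r (normal_pdf_ge0 m s _) (gA _))).
  rewrite /C -[leLHS]mulrA -[leRHS]mulrA ler_wpM2l//.
  have := phiK (z n); rewrite -(real_normK (num_real (z n - m))).
  have := normal_pdf_ge0 m s (z n).
  have nv : n.+1%:R <= `|z n - m| + `|m|.
    by rewrite -zn -{1}(subrK m (z n)) ler_normD.
  move: nv (normr_ge0 (z n - m)) (normr_ge0 m).
  move: (normal_pdf m s (z n)) `|z n - m| `|m| => phi v w nv v0 w0 phi0 vK.
  rewrite /harmonic ler_pdivlMr ?ltr0n//.
  have h1 : (1 + v) * phi * n.+1%:R <= (1 + v) * phi * ((1 + w) * (1 + v)).
    by apply: ler_wpM2l; [rewrite mulr_ge0// addr_ge0|nra].
  have h2 : (1 + v) * (1 + v) * phi <= 2 * ((1 + v ^+ 2) * phi).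
    by rewrite mulrA ler_wpM2r//; have := sqr_ge0 (1 - v); nra.
  apply: (le_trans h1).
  rewrite (_ : _ * _ = (1 + v) * (1 + v) * phi * (1 + w)); last by ring.
  apply: ler_wpM2r; first by rewrite addr_ge0.
  by apply: (le_trans h2); rewrite ler_wpM2l.
apply: norm_cvg0; apply: (@squeeze_cvgr _ _ _ _ (cst 0) (fun n => C * harmonic n)).
- by apply: nearW => n; rewrite normr_ge0 gz.
- exact: cvg_cst.
- rewrite -[X in _ --> X](mulr0 C); apply: cvgMr; exact: cvg_harmonic.
Qed.

(* Integration by parts: [((x-m) g - s^2 g') phi = (- s^2 g phi)'] for the normal
   density [phi]. *)
Lemma stein_identity (m s A : R) (g g' f1 f2 : R -> R) : s != 0 ->
  (forall x : R, is_derive x 1 g (g' x)) -> continuous g' ->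
  (forall x, `|g x| <= A * (1 + `|x - m|)) ->
  (forall x, `|g' x| <= A * (1 + (x - m) ^+ 2)) ->
  measurable_fun setT f2 ->
  (forall x, 0 <= f1 x) ->
  (forall x, 0 <= f2 x <= A * (1 + (x - m) ^+ 2)) ->
  (forall x, f1 x = f2 x + ((x - m) * g x - s ^+ 2 * g' x)) ->
  (\int[normal_prob m s]_x (f1 x)%:E = \int[normal_prob m s]_x (f2 x)%:E)%E.
Proof.
move=> s0 dg cg' gA g'A mf2 f10 f20 f12.
have cg : continuous g by move=> x; exact: is_derive_continuous (dg x).
pose psi x := (x - m) * g x - s ^+ 2 * g' x.
have cpsi : continuous psi.
  move=> x; apply: cvgB.
    by apply: cvgM; [apply: cvgB; [exact: cvg_id|exact: cvg_cst]|exact: cg].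
  by apply: cvgM; [exact: cvg_cst|exact: cg'].
have mpsi : measurable_fun setT psi by exact: continuous_measurable_fun.
have mf1 : measurable_fun setT f1.
  rewrite (_ : f1 = f2 \+ psi); first exact: measurable_funD.
  by apply/funext => x; rewrite f12.
have A0 : 0 <= A.
  have := le_trans (normr_ge0 _) (gA m).
  by rewrite subrr normr0 addr0 mulr1.
have ipsi : mu.-integrable setT (EFin \o (fun x => psi x * normal_pdf m s x)).
  apply: (@integrable_normal_pdf_quadratic _ _ (2 * A + s ^+ 2 * A)) => // x.
  apply: (le_trans (ler_normB _ _)); rewrite [leRHS]mulrDl; apply: lerD.
    rewrite normrM; apply: (le_trans (ler_wpM2l (normr_ge0 _) (gA x))).
    rewrite -(real_normK (num_real (x - m))).
    have v0 : 0 <= `|x - m| by []; move: `|x - m| v0 => v v0.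
    by have := sqr_ge0 (1 - v); nra.
  by rewrite normrM ger0_norm ?sqr_ge0// -mulrA ler_wpM2l// sqr_ge0.
have if2 : mu.-integrable setT (EFin \o (fun x => f2 x * normal_pdf m s x)).
  apply: (@integrable_normal_pdf_quadratic _ _ A) => // x.
  by have /andP[h1 h2] := f20 x; rewrite ger0_norm.
rewrite ge0_integral_normal_prob; last 2 first.
- exact/measurable_EFinP.
- by move=> x; rewrite lee_fin.
rewrite ge0_integral_normal_prob; last 2 first.
- exact/measurable_EFinP.
- by move=> x; rewrite lee_fin; have /andP[] := f20 x.
under eq_integral => x _.
  rewrite f12 -EFinM mulrDl EFinD -/(psi x). over.
(* Both summands are integrable, so it remains to see that [psi] integrates to 0 against the
   density; this is the limit of the boundary values of F. *)
rewrite /= integralD//.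
rewrite [X in (_ + X)%E](_ : _ = 0%E) ?adde0//.
rewrite -[LHS]fineK ?(integrable_fin_num measurableT)//; congr EFin.
pose F x := - (s ^+ 2) * (g x * normal_pdf m s x).
have dF (x : R) : setT x -> is_derive x 1 F (psi x * normal_pdf m s x).
  move=> _; have := is_derive_mulcst (- (s ^+ 2))
    (is_derive_mulfun (dg x) (is_derive_normal_pdf m x s0)).
  by move/is_derive_eq; apply; rewrite /psi; field.
have cpp (x : R) : setT x -> {for x, continuous (fun x => psi x * normal_pdf m s x)}.
  by move=> _; apply: cvgM; [exact: cpsi|exact: continuous_normal_pdf].
have := cvg_integral_exhausts exhausts_setT ipsi dF cpp.
have : F n.+1%:R - F (- n.+1%:R) @[n --> \oo] --> 0.
  rewrite -[X in _ --> X](subrr 0) -{2}(mulr0 (- (s ^+ 2))) -{1}(mulr0 (- (s ^+ 2))).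
  apply: cvgB; apply: cvgMr; apply: (linear_growth_normal_pdf_cvg0 s0 gA) => n.
    by rewrite ger0_norm.
  by rewrite normrN ger0_norm.
by move=> F0 Fl; apply/esym; exact: (cvg_unique _ F0 Fl).
Qed.

End normal.

(** * Normal likelihood *)

Lemma integral_probability_cst {d} {T : measurableType d} {R : realType}
  (P : probability T R) (c : R) : (\int[P]_x c%:E = c%:E)%E.
Proof. by rewrite integral_cst//= probability_setT mule1. Qed.

(** Induction on n: the first coordinate changes measure by its own density, whose value then enters
    the integral over the remaining ones as a constant. *)
Lemma ge0_integral_prod_density {d} {T : measurableType d} {R : realType} n
    (P Q : 'I_n -> probability T R) (e : 'I_n -> T -> R) :
  (forall i, measurable_fun setT (e i)) -> (forall i x, 0 <= e i x) ->
  (forall i (f : T -> \bar R), measurable_fun setT f -> (forall x, (0 <= f x)%E) ->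
    (\int[P i]_x f x = \int[Q i]_x (f x * (e i x)%:E))%E) ->
  forall f : n.-tuple T -> \bar R,
  measurable_fun setT f -> (forall y, (0 <= f y)%E) ->
  (\int[prod_prob P]_y f y =
   \int[prod_prob Q]_y (f y * (\prod_(i < n) e i (tnth y i))%:E))%E.
Proof.
elim: n P Q e => [|n IHn] P Q e me e0 PQ f mf f0.
  by apply: eq_integral => y _; rewrite big_ord0 mule1.
have mprod k (u : 'I_k -> T -> R) : (forall i, measurable_fun setT (u i)) ->
    measurable_fun setT (fun y : k.-tuple T => \prod_(i < k) u i (tnth y i)).
  move=> mu; apply: measurable_prod => i _; apply: (measurableT_comp (mu i)).
  exact: measurable_tnth.
have prod0 k (u : 'I_k -> T -> R) (y : k.-tuple T) : (forall i x, 0 <= u i x) ->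
    (0 <= (\prod_(i < k) u i (tnth y i))%:E)%E.
  by move=> u0; rewrite lee_fin; apply: prodr_ge0.
rewrite [LHS]ge0_integral_prod_prob// [RHS]ge0_integral_prod_prob; last 2 first.
- by apply: emeasurable_funM => //; apply/measurable_EFinP; exact: mprod.
- by move=> y; rewrite mule_ge0// prod0.
pose e' i := e (lift ord0 i).
pose h (z : T * n.-tuple T) :=
  (f (cons_pair z) * (\prod_(i < n) e' i (tnth z.2 i))%:E)%E.
have mh : measurable_fun setT h.
  apply: emeasurable_funM.
    by apply: measurableT_comp => //; exact: measurable_cons_pair.
  apply/measurable_EFinP; apply: (measurableT_comp (mprod _ e' _)) => //.
  by move=> i; exact: me.
have h0 z : (0 <= h z)%E by rewrite mule_ge0// prod0// => i x; exact: e0.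
transitivity (\int[P ord0]_x \int[prod_prob (fun i => Q (lift ord0 i))]_y h (x, y))%E.
  apply: eq_integral => x _.
  rewrite (IHn _ (fun i => Q (lift ord0 i)) e')//.
  - by move=> i; exact: me.
  - by move=> i z; exact: e0.
  - by move=> i; exact: PQ.
  - exact: measurable_section_cons.
rewrite PQ; last 2 first.
- exact: (@measurable_fun_fubini_tonelli_F _ _ _ _ R
    (prod_prob (fun i => Q (lift ord0 i))) h mh h0).
- by move=> x; exact: integral_ge0.
apply: eq_integral => x _; rewrite -ge0_integralZr//.
- apply: eq_integral => y _; rewrite /h -muleA -EFinM big_ord_recl mulrC tnth0.
  congr (_ * (_ * _)%:E)%E.
  by apply: eq_bigr => i _; rewrite tnthS.
- by apply: (measurableT_comp mh); exact: measurable_pair1.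
- by rewrite lee_fin e0.
Qed.

Section likelihood.
Context {R : realType}.
Local Notation mu := (@lebesgue_measure R).

(** Density of N_n(m, I_n) with respect to N_n(0, I_n). A common reference law for all parameters
    lets Tonelli exchange parameter and observation. *)
Definition likelihood n (m : 'I_n -> R) (y : vec R n) : R :=
  \prod_(i < n) expR (m i * tnth y i - m i ^+ 2 / 2).

Lemma likelihood_ge0 n (m : 'I_n -> R) y : 0 <= likelihood m y.
Proof. by apply: prodr_ge0 => i _; exact: expR_ge0. Qed.

Lemma measurable_tnthR n (i : 'I_n) :
  measurable_fun setT (fun y : vec R n => tnth y i : R).
Proof. exact: measurable_tnth. Qed.

Lemma measurable_likelihood2 n : measurable_fun setT
  (fun z : vec R n * vec R n => likelihood (tnth z.1) z.2).
Proof.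
apply: measurable_prod => i _; apply: measurableT_comp => //.
have m1 : measurable_fun setT (fun z : vec R n * vec R n => tnth z.1 i : R).
  by apply: (measurableT_comp (measurable_tnthR i)).
have m2 : measurable_fun setT (fun z : vec R n * vec R n => tnth z.2 i : R).
  by apply: (measurableT_comp (measurable_tnthR i)).
apply: measurable_funB; first exact: measurable_funM.
by apply: measurable_funM => //; exact: measurable_funX.
Qed.

Lemma ge0_integral_normal_prob_shift (m : R) (f : R -> \bar R) :
  measurable_fun setT f -> (forall x, (0 <= f x)%E) ->
  (\int[normal_prob m 1]_x f x =
   \int[normal_prob 0 1]_x (f x * (expR (m * x - m ^+ 2 / 2))%:E))%E.
Proof.
move=> mf f0; rewrite ge0_integral_normal_prob//.
rewrite ge0_integral_normal_prob; last 2 first.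
- apply: emeasurable_funM => //; apply/measurable_EFinP.
  by apply: measurableT_comp => //; exact: measurable_funB.
- by move=> x; rewrite mule_ge0// lee_fin expR_ge0.
apply: eq_integral => x _; rewrite -muleA -EFinM; congr (_ * _%:E)%E.
rewrite !normal_pdf_expR ?oner_eq0// [RHS]mulrCA -expRD; congr (_ * expR _).
by field.
Qed.

Lemma ge0_integral_likelihood n (m : 'I_n -> R) (f : vec R n -> \bar R) :
  measurable_fun setT f -> (forall y, (0 <= f y)%E) ->
  (\int[prod_prob (fun i => normal_prob (m i) 1)]_y f y =
   \int[prod_prob (fun i : 'I_n => normal_prob (0 : R) 1)]_y
     (f y * (likelihood m y)%:E))%E.
Proof.
apply: (@ge0_integral_prod_density _ (measurableTypeR R) R n
  (fun i => normal_prob (m i) 1) (fun=> normal_prob 0 1)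
  (fun i x => expR (m i * x - m i ^+ 2 / 2))).
- by move=> i; apply: measurableT_comp => //; exact: measurable_funB.
- by move=> i x; exact: expR_ge0.
- by move=> i g mg g0; exact: ge0_integral_normal_prob_shift.
Qed.

Lemma integral_likelihood n (m : 'I_n -> R) :
  (\int[prod_prob (fun i : 'I_n => normal_prob (0 : R) 1)]_y
     (likelihood m y)%:E = 1)%E.
Proof.
have := @ge0_integral_likelihood n m (cst 1%E) (measurable_cst _) (fun=> lee01).
rewrite integral_probability_cst => ->.
by apply: eq_integral => y _; rewrite mul1e.
Qed.

(* The posterior of [x ~ N(0, V/(1-V))] given [y ~ N(x, 1)] is [N(V y, V)]. *)
Lemma normal_pdf_posterior (V y x : R) : 0 < V < 1 ->
  expR (x * y - x ^+ 2 / 2) * normal_pdf 0 (Num.sqrt (V / (1 - V))) x =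
  normal_peak (Num.sqrt (V / (1 - V))) / normal_peak (Num.sqrt V) *
    expR (V * y ^+ 2 / 2) * normal_pdf (V * y) (Num.sqrt V) x.
Proof.
move=> /andP[V0 V1]; have V1' : 0 < 1 - V by rewrite subr_gt0.
have s0 : Num.sqrt V != 0 by rewrite gt_eqF// sqrtr_gt0.
have t0 : Num.sqrt (V / (1 - V)) != 0 by rewrite gt_eqF// sqrtr_gt0 divr_gt0.
rewrite !normal_pdf_expR// !sqr_sqrtr ?ltW ?divr_gt0//.
rewrite mulrCA -expRD -mulrA [X in _ = _ * X]mulrCA -expRD !mulrA.
rewrite divfK; last by rewrite gt_eqF// normal_peak_gt0.
congr (_ * expR _); field.
by rewrite !gt_eqF.
Qed.

Lemma integral_normal_prob_sqr_dist (m d V : R) : 0 < V ->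
  (\int[normal_prob m (Num.sqrt V)]_x ((d - x) ^+ 2)%:E =
   (V + (m - d) ^+ 2)%:E)%E.
Proof.
move=> V0; have s0 : Num.sqrt V != 0 by rewrite gt_eqF// sqrtr_gt0.
pose A := 1 + 2 * `|m - d| + V + (m - d) ^+ 2.
have md0 : 0 <= `|m - d| by [].
have md2 : 0 <= (m - d) ^+ 2 by exact: sqr_ge0.
have A1 : 1 <= A by rewrite /A; lra.
transitivity (\int[normal_prob m (Num.sqrt V)]_x (V + (m - d) ^+ 2)%:E)%E.
  (* The factor g is chosen so that (x - m) g(x) = (x - d)^2 - (m - d)^2, while s^2 g' = V. *)
  apply: (@stein_identity _ m (Num.sqrt V) A (fun x => x + (m - 2 * d))
    (cst 1) (fun x => (d - x) ^+ 2) (cst (V + (m - d) ^+ 2))) => //.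
  - move=> x; rewrite -[cst 1 x]addr0; apply: is_derive_addfun.
  - by move=> x; exact: cvg_cst.
  - move=> x; rewrite (_ : _ + _ = (x - m) + 2 * (m - d)); last by ring.
    apply: (le_trans (ler_normD _ _)); rewrite normrM [`|2|]ger0_norm//.
    by rewrite /A; move: `|x - m| (normr_ge0 (x - m)) => v v0; nra.
  - move=> x; rewrite /cst normr1.
    by have := sqr_ge0 (x - m); nra.
  - by move=> x; exact: sqr_ge0.
  - move=> x /=; apply/andP; split; first lra.
    apply: (@le_trans _ _ (A * 1)); first by rewrite /A; lra.
    by rewrite ler_wpM2l ?lerDl ?sqr_ge0//; lra.
  - by move=> x; rewrite sqr_sqrtr ?ltW//=; ring.
exact: integral_probability_cst.
Qed.

(** Under the posterior N(V y, V) the mean squared distance to any d is V plus a square. *)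
Lemma posterior_risk_ge (V y d : R) : 0 < V < 1 ->
  (\int[normal_prob 0 (Num.sqrt (V / (1 - V)))]_x
     (V * expR (x * y - x ^+ 2 / 2))%:E <=
   \int[normal_prob 0 (Num.sqrt (V / (1 - V)))]_x
     ((d - x) ^+ 2 * expR (x * y - x ^+ 2 / 2))%:E)%E.
Proof.
move=> V01; have /andP[V0 V1] := V01.
(* The marginal density of y relative to N(0, 1), that is, the normalizing factor of the
   posterior. *)
pose C := normal_peak (Num.sqrt (V / (1 - V))) / normal_peak (Num.sqrt V) *
    expR (V * y ^+ 2 / 2).
have C0 : 0 <= C.
  by rewrite !mulr_ge0 ?invr_ge0 ?normal_peak_ge0 ?expR_ge0.
have mexp : measurable_fun setT (fun x : R => expR (x * y - x ^+ 2 / 2)).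
  apply: measurableT_comp => //; apply: measurable_funB => //.
    exact: measurable_funM.
  by apply: measurable_funM => //; exact: measurable_funX.
have change (f : R -> R) : measurable_fun setT f -> (forall x, 0 <= f x) ->
    (\int[normal_prob 0 (Num.sqrt (V / (1 - V)))]_x
      (f x * expR (x * y - x ^+ 2 / 2))%:E =
     C%:E * \int[normal_prob (V * y) (Num.sqrt V)]_x (f x)%:E)%E.
  move=> mf f0; rewrite ge0_integral_normal_prob; last 2 first.
  - by apply/measurable_EFinP; exact: measurable_funM.
  - by move=> x; rewrite lee_fin mulr_ge0// expR_ge0.
  rewrite -ge0_integralZl//; last 2 first.
  - exact/measurable_EFinP.
  - by move=> x _; rewrite lee_fin.
  rewrite ge0_integral_normal_prob; last 2 first.
  - by apply/measurable_EFinP; exact: measurable_funM.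
  - by move=> x; rewrite lee_fin mulr_ge0.
  apply: eq_integral => x _; rewrite -!EFinM -(mulrA (f x)) normal_pdf_posterior// -/C.
  by congr EFin; ring.
rewrite (change (cst V))//; last by move=> x; exact: ltW.
rewrite [leRHS](change (fun x => (d - x) ^+ 2)); last 2 first.
- by apply: measurable_funX; exact: measurable_funB.
- by move=> x; exact: sqr_ge0.
rewrite integral_normal_prob_sqr_dist// integral_probability_cst.
by rewrite lee_wpmul2l ?lee_fin// lerDl sqr_ge0.
Qed.

End likelihood.

(** * Lower bound on the maximal risk *)

Section minimax_lower_bound.
Context {R : realType}.

Lemma likelihood_tupdate n (b y : vec R n) (i : 'I_n) (x : R) :
  likelihood (tnth (tupdate b i x)) y =
  expR (x * tnth y i - x ^+ 2 / 2) *
  \prod_(j < n | j != i) expR (tnth b j * tnth y j - tnth b j ^+ 2 / 2).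
Proof.
rewrite /likelihood (bigD1 i)//= tnth_tupdate eqxx; congr (_ * _).
by apply: eq_bigr => j /negPf ji; rewrite tnth_tupdate ji.
Qed.

Lemma measurable_sqdist2 p (delta : vec R p -> vec R p) :
  measurable_fun setT delta ->
  measurable_fun setT (fun z : vec R p * vec R p => sqdist (delta z.2) z.1).
Proof.
move=> md; apply: measurable_sum => i; apply: measurable_funX.
apply: measurable_funB.
  apply: (measurableT_comp (measurable_tnthR i)).
  exact: (measurableT_comp md measurable_snd).
by apply: (measurableT_comp (measurable_tnthR i)).
Qed.

Lemma sqdist_ge0 p (x y : vec R p) : 0 <= sqdist x y.
Proof. by apply: sumr_ge0 => i _; exact: sqr_ge0. Qed.

(** The loss is a sum over coordinates and the likelihood a product. For the i-th summand only
    coordinate i of b is integrated; the other factors are constants, and the scalar bound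
    applies. *)
Lemma posterior_sqdist_ge (V : R) p (d y : vec R p) : 0 < V < 1 ->
  ((p%:R * V)%:E *
    \int[prod_prob (fun i : 'I_p => normal_prob (0 : R) (Num.sqrt (V / (1 - V))))]_b
      (likelihood (tnth b) y)%:E <=
   \int[prod_prob (fun i : 'I_p => normal_prob (0 : R) (Num.sqrt (V / (1 - V))))]_b
     (sqdist d b * likelihood (tnth b) y)%:E)%E.
Proof.
move=> V01; set P := prod_prob _; have /andP[V0 V1] := V01.
have mL : measurable_fun setT (fun b : vec R p => likelihood (tnth b) y).
  exact: (measurableT_comp (measurable_likelihood2 (n := p)) (measurable_pair2 y)).
have mi i : measurable_fun setT
    (fun b : vec R p => (tnth d i - tnth b i) ^+ 2 * likelihood (tnth b) y).
  apply: measurable_funM => //; apply: measurable_funX; apply: measurable_funB => //.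
  exact: measurable_tnthR.
under [leRHS]eq_integral do rewrite /sqdist mulr_suml -sumEFin.
rewrite ge0_integral_sum//; last 2 first.
- by move=> i; apply/measurable_EFinP; exact: mi.
- by move=> i b _; rewrite lee_fin mulr_ge0 ?sqr_ge0 ?likelihood_ge0.
apply: (@le_trans _ _ (\sum_(i < p) \int[P]_b (V * likelihood (tnth b) y)%:E)%E).
  have -> : (\int[P]_b (V * likelihood (tnth b) y)%:E =
      V%:E * \int[P]_b (likelihood (tnth b) y)%:E)%E.
    rewrite -ge0_integralZl//.
    - exact/measurable_EFinP.
    - by move=> b _; rewrite lee_fin likelihood_ge0.
    - by rewrite lee_fin ltW.
  rewrite EFinM -muleA.
  have -> : (p%:R%:E = \sum_(i < p) 1%:E :> \bar R)%E.
    by rewrite sumEFin sumr_const card_ord.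
  rewrite ge0_sume_distrl; last by move=> i _; rewrite lee_fin.
  by under eq_bigr do rewrite mul1e.
apply: lee_sum => i _.
apply: (@le_integral_sections _ (measurableTypeR R) R p _ i).
- by apply/measurable_EFinP; exact: measurable_funM.
- by apply/measurable_EFinP; exact: mi.
- by move=> b; rewrite lee_fin mulr_ge0 ?likelihood_ge0 ?ltW.
- by move=> b; rewrite lee_fin mulr_ge0 ?sqr_ge0 ?likelihood_ge0.
move=> b.
under eq_integral do rewrite likelihood_tupdate mulrA EFinM.
under [leRHS]eq_integral do rewrite likelihood_tupdate mulrA EFinM tnth_tupdate eqxx.
have K0 : (0 <= (\prod_(j < p | j != i)
    expR (tnth b j * tnth y j - tnth b j ^+ 2 / 2))%:E)%E.
  by rewrite lee_fin prodr_ge0// => j _; exact: expR_ge0.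
have me : measurable_fun setT (fun x : R => expR (x * tnth y i - x ^+ 2 / 2)).
  apply: measurableT_comp => //; apply: measurable_funB; first exact: measurable_funM.
  by apply: measurable_funM => //; exact: measurable_funX.
rewrite ge0_integralZr//; last 2 first.
- by apply/measurable_EFinP; exact: measurable_funM.
- by move=> x _; rewrite lee_fin mulr_ge0 ?expR_ge0 ?ltW.
rewrite [leRHS]ge0_integralZr//; last 2 first.
- apply/measurable_EFinP; apply: measurable_funM => //.
  by apply: measurable_funX; exact: measurable_funB.
- by move=> x _; rewrite lee_fin mulr_ge0 ?expR_ge0 ?sqr_ge0.
by apply: lee_wpmul2r => //; exact: posterior_risk_ge.
Qed.

Lemma risk_likelihood p (delta : vec R p -> vec R p) (b : vec R p) :
  measurable_fun setT delta ->
  (risk delta b = \int[prod_prob (fun i : 'I_p => normal_prob (0 : R) 1)]_y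
    (sqdist (delta y) b * likelihood (tnth b) y)%:E)%E.
Proof.
move=> md; rewrite /risk /gaussian.
have msq : measurable_fun setT (fun y : vec R p => (sqdist (delta y) b)%:E).
  apply/measurable_EFinP.
  exact: (measurableT_comp (measurable_sqdist2 md) (measurable_pair1 b)).
have sq0 (y : vec R p) : (0 <= (sqdist (delta y) b)%:E)%E.
  by rewrite lee_fin sqdist_ge0.
rewrite (ge0_integral_likelihood (tnth b) msq sq0).
by apply: eq_integral => y _; rewrite EFinM.
Qed.

Lemma risk_le_sup p (delta : vec R p -> vec R p) (b : vec R p) :
  (risk delta b <= sup_risk delta)%E.
Proof.
by apply: ereal_sup_ubound; exact: (ex_intro2 _ _ b Logic.I (erefl (risk delta b))).
Qed.

(* The supremum of the risk dominates the Bayes risk of the prior [P]; Tonelli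
   reduces the latter to the posterior risk at each observation. *)
Lemma sup_risk_ge_posterior (c : R) p (P : probability (vec R p) R)
    (delta : vec R p -> vec R p) : 0 <= c ->
  (forall d y : vec R p, (c%:E * \int[P]_b (likelihood (tnth b) y)%:E <=
     \int[P]_b (sqdist d b * likelihood (tnth b) y)%:E)%E) ->
  measurable_fun setT delta -> (c%:E <= sup_risk delta)%E.
Proof.
move=> c0 post md.
pose G := prod_prob (fun i : 'I_p => normal_prob (0 : R) 1).
pose Phi (z : vec R p * vec R p) :=
  (sqdist (delta z.2) z.1 * likelihood (tnth z.1) z.2)%:E.
pose L (z : vec R p * vec R p) := (likelihood (tnth z.1) z.2)%:E.
have mPhi : measurable_fun setT Phi.
  apply/measurable_EFinP; apply: measurable_funM.
    exact: measurable_sqdist2.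
  exact: measurable_likelihood2.
have mL : measurable_fun setT L.
  by apply/measurable_EFinP; exact: measurable_likelihood2.
have Phi0 z : (0 <= Phi z)%E by rewrite lee_fin mulr_ge0 ?sqdist_ge0 ?likelihood_ge0.
have L0 z : (0 <= L z)%E by rewrite lee_fin likelihood_ge0.
have riskE b : risk delta b = (\int[G]_y Phi (b, y))%E by exact: risk_likelihood.
have : (\int[P]_b \int[G]_y Phi (b, y) <= sup_risk delta)%E.
  have mF : measurable_fun setT (fun b => \int[G]_y Phi (b, y))%E.
    exact: (@measurable_fun_fubini_tonelli_F _ _ _ _ R G Phi mPhi Phi0).
  (* The value +oo is trivial, -oo contradicts the nonnegative risk at the zero vector, and a finite
     value integrates to itself under P. *)
  case supE : (sup_risk delta) => [r| |]; last 2 first.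
  - by rewrite leey.
  - have := risk_le_sup delta (nseq_tuple p 0); rewrite supE leeNy_eq riskE => /eqP E.
    suff : (0%E <= -oo :> \bar R)%E by [].
    by rewrite -E; exact: integral_ge0.
  rewrite -(integral_probability_cst P r); apply: ge0_le_integral => //.
  - by move=> b _; exact: integral_ge0.
  - by move=> b _; rewrite -supE -riskE; exact: risk_le_sup.
apply: le_trans.
rewrite (fubini_tonelli Phi mPhi Phi0).
apply: (@le_trans _ _ (\int[G]_y (c%:E * \int[P]_b L (b, y))))%E.
  have mLG : measurable_fun setT (fun y => \int[P]_b L (b, y))%E.
    exact: (@measurable_fun_fubini_tonelli_G _ _ _ _ R P L mL L0).
  rewrite ge0_integralZl//; last by move=> y _; exact: integral_ge0.
  rewrite -(fubini_tonelli L mL L0).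
  (* For each parameter the likelihood is a probability density in y. *)
  have -> : (\int[P]_b \int[G]_y L (b, y) = 1)%E; last by rewrite mule1.
  transitivity (\int[P]_b 1%:E)%E; last exact: integral_probability_cst.
  by apply: eq_integral => b _; exact: (integral_likelihood (tnth b)).
apply: ge0_le_integral => //.
- by move=> y _; rewrite mule_ge0 ?integral_ge0// lee_fin.
- apply: measurable_funeM.
  exact: (@measurable_fun_fubini_tonelli_G _ _ _ _ R P L mL L0).
- exact: (@measurable_fun_fubini_tonelli_G _ _ _ _ R P Phi mPhi Phi0).
- by move=> y _; exact: (post (delta y) y).
Qed.

Lemma sup_risk_ge_shrunk (V : R) p (delta : vec R p -> vec R p) : 0 < V < 1 ->
  measurable_fun setT delta -> ((p%:R * V)%:E <= sup_risk delta)%E.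
Proof.
move=> V01; apply: (@sup_risk_ge_posterior _ _
  (prod_prob (fun i : 'I_p => normal_prob (0 : R) (Num.sqrt (V / (1 - V)))))).
  by have /andP[/ltW V0 _] := V01; rewrite mulr_ge0.
by move=> d y; exact: (posterior_sqdist_ge d y V01).
Qed.

Lemma sup_risk_ge p (delta : vec R p -> vec R p) :
  measurable_fun setT delta -> (p%:R%:E <= sup_risk delta)%E.
Proof.
move=> md; case supE : (sup_risk delta) => [r| |].
- rewrite lee_fin leNgt; apply/negP => rp.
  have p0 : 0 < p%:R :> R.
    rewrite ltNge; apply/negP => p0.
    have V01 : 0 < (2^-1 : R) < 1 by lra.
    have := sup_risk_ge_shrunk V01 md; rewrite supE lee_fin.
    have : 0 <= p%:R :> R by [].
    by nra.
  (* Then p V is at least the midpoint of r and p, hence exceeds r. The maximum with 1/2 keeps V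
     positive whatever the sign of r + p. *)
  pose V := Num.max 2^-1 ((r + p%:R) / 2 / p%:R).
  have V01 : 0 < V < 1.
    rewrite lt_max gt_max ltr_pdivrMr//; apply/and3P; split; [|lra|lra].
    by apply/orP; left; lra.
  have := sup_risk_ge_shrunk V01 md; rewrite supE lee_fin leNgt => /negP; apply.
  apply: (@lt_le_trans _ _ ((r + p%:R) / 2)); first lra.
  by rewrite [leRHS]mulrC -ler_pdivrMr// le_max lexx orbT.
- by rewrite leey.
- have V01 : 0 < (2^-1 : R) < 1 by lra.
  by have := sup_risk_ge_shrunk V01 md; rewrite supE.
Qed.

End minimax_lower_bound.

(** * Risk of shrinkage estimators *)

Section shrinkage_risk.
Context {R : realType}.

Lemma sqnorm_ge0 n (y : vec R n) : 0 <= sqnorm y.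
Proof. by apply: sumr_ge0 => i _; exact: sqr_ge0. Qed.

Lemma measurable_sqnorm n : measurable_fun setT (@sqnorm R n).
Proof.
by apply: measurable_sum => i; apply: measurable_funX; exact: measurable_tnthR.
Qed.

Lemma sqnorm_tupdate n (y : vec R n) (i : 'I_n) (x : R) :
  sqnorm (tupdate y i x) = x ^+ 2 + \sum_(j < n | j != i) (tnth y j : R) ^+ 2.
Proof.
rewrite /sqnorm (bigD1 i)//= tnth_tupdate eqxx; congr (_ + _).
by apply: eq_bigr => j /negPf ji; rewrite tnth_tupdate ji.
Qed.

Definition shrink p (r : R -> R) (y : vec R p) : vec R p :=
  [tuple (1 - r (sqnorm y)) * (tnth y i : R) | i < p].

Lemma tnth_shrink p (r : R -> R) (y : vec R p) i :
  tnth (shrink r y) i = (1 - r (sqnorm y)) * (tnth y i : R).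
Proof. by rewrite tnth_mktuple. Qed.

Lemma measurable_shrink p (r : R -> R) : continuous r ->
  measurable_fun setT (@shrink p r).
Proof.
move=> cr; apply/measurable_fun_tnthP => i.
rewrite (_ : _ \o _ =
  fun y : vec R p => (1 - r (sqnorm y)) * (tnth y i : R)); last first.
  by apply/funext => y /=; rewrite tnth_shrink.
apply: measurable_funM; last exact: measurable_tnthR.
apply: measurable_funB => //; apply: measurableT_comp.
  exact: continuous_measurable_fun.
exact: measurable_sqnorm.
Qed.

(* Stein's unbiased risk estimate in one coordinate; the [+ 1] makes both
   integrands nonnegative. *)
Lemma stein_shrink_section (r r' : R -> R) (c b : R) :
  (forall s : R, is_derive s 1 r (r' s)) -> continuous r' ->
  (forall s, 0 <= r s <= 1) -> (forall s, -1 <= r' s <= 0) ->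
  (\int[normal_prob b 1]_x
     (((1 - r (x ^+ 2 + c)) * x - b) ^+ 2 + 1)%:E =
   \int[normal_prob b 1]_x
     (2 - 2 * r (x ^+ 2 + c) - 4 * r' (x ^+ 2 + c) * x ^+ 2 +
       r (x ^+ 2 + c) ^+ 2 * x ^+ 2)%:E)%E.
Proof.
move=> dr cr' r01 r'01.
have cr : continuous r by move=> s; exact: is_derive_continuous (dr s).
have cq : continuous (fun x : R => x ^+ 2 + c).
  by move=> x; apply: cvgD; [exact: exprn_continuous|exact: cvg_cst].
have crq : continuous (fun x : R => r (x ^+ 2 + c)).
  by move=> x; apply: continuous_comp; [exact: cq|exact: cr].
have cr'q : continuous (fun x : R => r' (x ^+ 2 + c)).
  by move=> x; apply: continuous_comp; [exact: cq|exact: cr'].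
have cx2 : continuous (fun x : R => x ^+ 2) by move=> x; exact: exprn_continuous.
(* (x - b) g(x) is the squared error without its term r^2 x^2. Stein's identity trades it for g',
   which leaves an integrand free of b. *)
pose g x := (x - b) - 2 * (r (x ^+ 2 + c) * x).
pose g' x := 1 - 2 * (r (x ^+ 2 + c) + 2 * r' (x ^+ 2 + c) * x ^+ 2).
have dg (x : R) : is_derive x 1 g (g' x).
  have did : is_derive x 1 (fun x : R => x) 1 by exact: is_derive_id.
  have dq : is_derive x 1 (fun x : R => x * x + c) (1 * x + x * 1 + 0).
    by apply: is_derive_addfun; apply: is_derive_mulfun.
  have dcomp : is_derive x 1 (fun x : R => r (x * x + c))
      (r' (x * x + c) * (1 * x + x * 1 + 0)).
    by apply: (is_derive1_comp (f := r)).
  have := is_derive_addfun (is_derive_addfun did (is_derive_cst (- b) x 1))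
    (is_derive_oppfun (is_derive_mulcst 2 (is_derive_mulfun dcomp did))).
  rewrite (_ : (fun u => _) = g); last first.
    by apply/funext => u; rewrite /g expr2.
  by move/is_derive_eq; apply; rewrite /g' expr2; ring.
have x2le x : x ^+ 2 <= 2 * (x - b) ^+ 2 + 2 * b ^+ 2.
  by have := sqr_ge0 (x - b - b); nra.
have b2 : 0 <= b ^+ 2 by exact: sqr_ge0.
have bb : 2 * `|b| <= 1 + b ^+ 2.
  by rewrite -(real_normK (num_real b)); have := sqr_ge0 (1 - `|b|); nra.
(* A crude common constant for the three growth conditions, obtained from x^2 <= 2 (x - b)^2 + 2 b^2
   and the bounds on r and r'. *)
apply: (@stein_identity _ b 1 (10 + 10 * b ^+ 2) g g' _ _ _ dg).
- exact: oner_neq0.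
- move=> x; apply: cvgB; first exact: cvg_cst.
  apply: cvgM; first exact: cvg_cst.
  apply: cvgD; first exact: crq.
  apply: cvgM; last exact: cx2.
  by apply: cvgM; [exact: cvg_cst|exact: cr'q].
- move=> x; rewrite /g; have /andP[r0 r1] := r01 (x ^+ 2 + c).
  apply: (le_trans (ler_normB _ _)); rewrite !normrM [`|2|]ger0_norm//.
  rewrite (ger0_norm r0).
  have : `|x| <= `|x - b| + `|b| by rewrite -{1}(subrK b x) ler_normD.
  move: (r _) r0 r1 => u u0 u1.
  move: `|x| (normr_ge0 x) `|x - b| (normr_ge0 (x - b)) => y y0 v v0 yv.
  have : u * y <= y by rewrite ler_piMl.
  by have := mulr_ge0 b2 v0; lra.
- move=> x; rewrite /g'; have /andP[r0 r1] := r01 (x ^+ 2 + c).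
  have /andP[r'0 r'1] := r'01 (x ^+ 2 + c).
  have := x2le x; have x20 := sqr_ge0 x; have v20 := sqr_ge0 (x - b).
  have bv := mulr_ge0 b2 v20.
  move: (x ^+ 2) ((x - b) ^+ 2) (r _) (r' _) r0 r1 r'0 r'1 x20 v20 bv =>
    X Y u w u0 u1 w0 w1 X0 Y0 bY XY.
  have : - X <= w * X by rewrite -mulN1r ler_wpM2r.
  have : w * X <= 0 by rewrite mulr_le0_ge0.
  by rewrite ler_norml => wX0 wX1; apply/andP; split; lra.
- apply: measurable_funD; last first.
    apply: measurable_funM; last exact: continuous_measurable_fun.
    by apply: measurable_funX; exact: continuous_measurable_fun.
  apply: measurable_funB; last first.
    apply: measurable_funM; last exact: continuous_measurable_fun.
    by apply: measurable_funM => //; exact: continuous_measurable_fun.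
  apply: measurable_funB => //.
  by apply: measurable_funM => //; exact: continuous_measurable_fun.
- by move=> x; rewrite addr_ge0// sqr_ge0.
- move=> x; have /andP[r0 r1] := r01 (x ^+ 2 + c).
  have /andP[r'0 r'1] := r'01 (x ^+ 2 + c).
  have := x2le x; have x20 := sqr_ge0 x; have v20 := sqr_ge0 (x - b).
  have bv := mulr_ge0 b2 v20.
  move: (x ^+ 2) ((x - b) ^+ 2) (r _) (r' _) r0 r1 r'0 r'1 x20 v20 bv =>
    X Y u w u0 u1 w0 w1 X0 Y0 bY XY.
  have : - X <= w * X by rewrite -mulN1r ler_wpM2r.
  have : w * X <= 0 by rewrite mulr_le0_ge0.
  have u2 : u ^+ 2 <= 1 by rewrite expr_le1.
  have : u ^+ 2 * X <= X by rewrite ler_piMl.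
  have : 0 <= u ^+ 2 * X by rewrite mulr_ge0 ?sqr_ge0.
  by rewrite -mulrA => uX0 uX1 wX0 wX1; apply/andP; split; lra.
- by move=> x; rewrite /g /g' expr1n; ring.
Qed.

(** Summed over coordinates, the added ones turn the loss into loss + p, and the unbiased estimate
    into 2 p plus the expression assumed nonpositive. The finite p then cancels. *)
Lemma risk_shrink_le p (r r' : R -> R) (b : vec R p) :
  (forall s : R, is_derive s 1 r (r' s)) -> continuous r' ->
  (forall s, 0 <= r s <= 1) -> (forall s, -1 <= r' s <= 0) ->
  (forall s, 0 <= s -> - 2 * p%:R * r s - 4 * r' s * s + r s ^+ 2 * s <= 0) ->
  (risk (shrink r) b <= p%:R%:E)%E.
Proof.
move=> dr cr' r01 r'01 rle.
have cr : continuous r by move=> s; exact: is_derive_continuous (dr s).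
pose A i (y : vec R p) := (tnth (shrink r y) i - tnth b i) ^+ 2 + 1 : R.
pose C i (y : vec R p) := 2 - 2 * r (sqnorm y) -
  4 * r' (sqnorm y) * (tnth y i : R) ^+ 2 +
  r (sqnorm y) ^+ 2 * (tnth y i : R) ^+ 2.
have mrs : measurable_fun setT (fun y : vec R p => r (sqnorm y)).
  apply: measurableT_comp; last exact: measurable_sqnorm.
  exact: continuous_measurable_fun.
have mr's : measurable_fun setT (fun y : vec R p => r' (sqnorm y)).
  apply: measurableT_comp; last exact: measurable_sqnorm.
  exact: continuous_measurable_fun.
have mA i : measurable_fun setT (A i).
  apply: measurable_funD => //; apply: measurable_funX; apply: measurable_funB => //.
  exact: (measurableT_comp (measurable_tnthR i) (measurable_shrink cr)).
have mti i : measurable_fun setT (fun y : vec R p => (tnth y i : R) ^+ 2).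
  by apply: measurable_funX; exact: measurable_tnthR.
have mC i : measurable_fun setT (C i).
  apply: measurable_funD; last first.
    by apply: measurable_funM => //; exact: measurable_funX.
  apply: measurable_funB; last first.
    by apply: measurable_funM => //; exact: measurable_funM.
  by apply: measurable_funB => //; exact: measurable_funM.
have A0 i y : 0 <= A i y by rewrite addr_ge0// sqr_ge0.
have C0 i y : 0 <= C i y.
  have /andP[r0 r1] := r01 (sqnorm y); have /andP[r'0 r'1] := r'01 (sqnorm y).
  rewrite /C addr_ge0//; last by rewrite mulr_ge0 ?sqr_ge0.
  have : r' (sqnorm y) * (tnth y i : R) ^+ 2 <= 0.
    by rewrite mulr_le0_ge0// sqr_ge0.
  by rewrite -mulrA; lra.
have AC i : (\int[gaussian b]_y (A i y)%:E <= \int[gaussian b]_y (C i y)%:E)%E.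
  apply: (@le_integral_sections _ (measurableTypeR R) R p _ i).
  - exact/measurable_EFinP.
  - exact/measurable_EFinP.
  - by move=> y; rewrite lee_fin.
  - by move=> y; rewrite lee_fin.
  move=> y; pose c : R := \sum_(j < p | j != i) (tnth y j : R) ^+ 2.
  have E := stein_shrink_section c (tnth b i) dr cr' r01 r'01.
  under [leLHS]eq_integral => x _ do rewrite /A tnth_shrink sqnorm_tupdate tnth_tupdate eqxx.
  under [leRHS]eq_integral => x _ do rewrite /C sqnorm_tupdate tnth_tupdate eqxx.
  by rewrite -/c E.
have riskp : (risk (shrink r) b + p%:R%:E <= p%:R%:E + p%:R%:E)%E.
  have -> : (risk (shrink r) b + p%:R%:E =
      \sum_(i < p) \int[gaussian b]_y (A i y)%:E)%E.
    rewrite -ge0_integral_sum//; [|by move=> i; exact/measurable_EFinP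
      |by move=> i y _; rewrite lee_fin].
    rewrite /risk -(integral_probability_cst (gaussian b)) -ge0_integralD//.
    - apply: eq_integral => y _; rewrite sumEFin -EFinD; congr EFin.
      by rewrite /A big_split/= sumr_const card_ord.
    - by move=> y _; rewrite lee_fin sqdist_ge0.
    - apply/measurable_EFinP; apply: measurable_sum => i; apply: measurable_funX.
      apply: measurable_funB => //.
      exact: (measurableT_comp (measurable_tnthR i) (measurable_shrink cr)).
  apply: (@le_trans _ _ (\sum_(i < p) \int[gaussian b]_y (C i y)%:E)%E).
    by apply: lee_sum => i _; exact: AC.
  rewrite -ge0_integral_sum//; [|by move=> i; exact/measurable_EFinP
    |by move=> i y _; rewrite lee_fin].
  rewrite -EFinD -(integral_probability_cst (gaussian b)); apply: ge0_le_integral => //.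
  - by move=> y _; rewrite sume_ge0// => i _; rewrite lee_fin.
  - by apply: emeasurable_sum => i; exact/measurable_EFinP.
  move=> y _; rewrite sumEFin lee_fin /C.
  rewrite big_split/= sumrB sumr_const card_ord -!mulr_sumr -/(sqnorm y).
  have := rle _ (sqnorm_ge0 y); move: (sqnorm y) (r _) (r' _) => s u w.
  by rewrite -[(2 - 2 * u) *+ p]mulr_natl; lra.
by move: riskp; rewrite leeD2rE.
Qed.

End shrinkage_risk.

(** * Weighted integrals over the unit interval *)

Section weighted_integral.
Context {R : realType}.
Local Notation mu := (@lebesgue_measure R).
Local Notation I01 := (`]0%R, 1%R[%classic : set R).
Implicit Types (f g : R -> R).

(** Multipliers that keep any integrable weight integrable. The class is closed under sums and
    products, which settles the integrability conditions of all later linear manipulations. *)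
Definition bounded_measurable f :=
  measurable_fun I01 f /\ exists C, forall k, I01 k -> `|f k| <= C.

Lemma bounded_measurableM f g : bounded_measurable f -> bounded_measurable g ->
  bounded_measurable (fun k => f k * g k).
Proof.
move=> [mf [C fC]] [mg [C' gC]]; split; first exact: measurable_funM.
exists (C * C') => k k01; rewrite normrM ler_pM//; [exact: fC|exact: gC].
Qed.

Lemma bounded_measurableD f g : bounded_measurable f -> bounded_measurable g ->
  bounded_measurable (fun k => f k + g k).
Proof.
move=> [mf [C fC]] [mg [C' gC]]; split; first exact: measurable_funD.
exists (C + C') => k k01; apply: (le_trans (ler_normD _ _)).
by rewrite lerD//; [exact: fC|exact: gC].
Qed.

Lemma bounded_measurable_cst c : bounded_measurable (cst c).
Proof. by split; [exact: measurable_cst|exists `|c|]. Qed.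

Lemma bounded_measurable_id : bounded_measurable id.
Proof.
split; first exact: measurable_id.
by exists 1 => k; rewrite /= in_itv/= => /andP[/ltW k0 /ltW]; rewrite ger0_norm.
Qed.

Lemma bounded_measurable_eq f g : (forall k, I01 k -> f k = g k) ->
  bounded_measurable f -> bounded_measurable g.
Proof.
move=> fg [mf [C fC]]; split.
  by apply: eq_measurable_fun mf => k /set_mem; exact: fg.
by exists C => k k01; rewrite -fg// fC.
Qed.

Lemma bounded_measurableB f g : bounded_measurable f -> bounded_measurable g ->
  bounded_measurable (fun k => f k - g k).
Proof.
move=> bf bg; apply: bounded_measurableD => //.
apply: (bounded_measurable_eq (f := fun k => (- 1) * g k)).
  by move=> k _; rewrite mulN1r.
by apply: bounded_measurableM => //; exact: bounded_measurable_cst.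
Qed.

Lemma bounded_measurable_expR (w : R) : bounded_measurable (fun k => expR (- (w * k))).
Proof.
split.
  apply: measurableT_comp => //; apply: (measurable_funS measurableT) => //.
  by apply: measurableT_comp => //; exact: measurable_funM.
exists (expR `|w|) => k; rewrite /= in_itv/= => /andP[k0 k1].
rewrite ger0_norm ?expR_ge0// ler_expR; apply: (le_trans (ler_norm _)).
by rewrite normrN normrM ler_piMr// ger0_norm ltW.
Qed.

Variable phi : R -> R.
Hypothesis phi_gt0 : forall k, I01 k -> 0 < phi k.
Hypothesis int_phi : mu.-integrable I01 (EFin \o phi).

Definition wint f := (\int[mu]_(k in I01) (f k * phi k))%R.

Lemma integrable_weight f : bounded_measurable f ->
  mu.-integrable I01 (EFin \o (fun k => f k * phi k)).
Proof.
move=> [mf [C fC]].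
have mphi : measurable_fun I01 phi.
  by apply/measurable_EFinP; exact: measurable_int int_phi.
apply: (@le_integrable _ _ _ mu _ (measurable_itv _) _
  (fun k => C%:E * (phi k)%:E)%E).
- by apply/measurable_EFinP; exact: measurable_funM.
- move=> k k01; rewrite /= lee_fin !normrM.
  apply: ler_wpM2r => //; apply: (le_trans (fC k k01)); exact: ler_norm.
- by apply: integrableZl => //; exact: measurable_itv.
Qed.

Lemma wint_eq f g : (forall k, I01 k -> f k = g k) -> wint f = wint g.
Proof. by move=> fg; apply: eq_Rintegral => k /set_mem /fg ->. Qed.

Lemma wintD f g : bounded_measurable f -> bounded_measurable g ->
  wint (fun k => f k + g k) = wint f + wint g.
Proof.
move=> bf bg; rewrite /wint -RintegralD//; try exact: integrable_weight.
by apply: eq_Rintegral => k _; rewrite mulrDl.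
Qed.

Lemma wintB f g : bounded_measurable f -> bounded_measurable g ->
  wint (fun k => f k - g k) = wint f - wint g.
Proof.
move=> bf bg; rewrite /wint -RintegralB//; try exact: integrable_weight.
by apply: eq_Rintegral => k _; rewrite mulrBl.
Qed.

Lemma wintZ c f : bounded_measurable f -> wint (fun k => c * f k) = c * wint f.
Proof.
move=> bf; rewrite /wint -RintegralZl//; last exact: integrable_weight.
by apply: eq_Rintegral => k _; rewrite mulrA.
Qed.

Lemma le_wint f g : bounded_measurable f -> bounded_measurable g ->
  (forall k, I01 k -> f k <= g k) -> wint f <= wint g.
Proof.
move=> bf bg fg; apply: le_Rintegral => //; try exact: integrable_weight.
by move=> k k01; rewrite ler_wpM2r ?fg// ltW// phi_gt0.
Qed.

Lemma wint_ge0 f : (forall k, I01 k -> 0 <= f k) -> 0 <= wint f.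
Proof.
by move=> f0; apply: Rintegral_ge0 => k k01; rewrite mulr_ge0 ?f0// ltW// phi_gt0.
Qed.

(** A zero integral would put ]0, 1[, of measure 1, inside a null set. *)
Lemma wint_gt0 f : bounded_measurable f -> (forall k, I01 k -> 0 < f k) ->
  0 < wint f.
Proof.
move=> bf f0; rewrite lt_neqAle wint_ge0 ?andbT; last by move=> k /f0/ltW.
apply/negP => /eqP W0; have ifphi := integrable_weight bf.
have fphi0 k : I01 k -> 0 < f k * phi k by move=> k01; rewrite mulr_gt0 ?f0 ?phi_gt0.
have : (\int[mu]_(k in I01) `|(f k * phi k)%:E|)%E = 0%E.
  under eq_integral => k /set_mem k01 do
    rewrite abse_EFin ger0_norm ?(ltW (fphi0 _ k01))//.
  by rewrite -[LHS]fineK ?integrable_fin_num//; congr EFin; exact: esym W0.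
have mf : measurable_fun I01 (EFin \o (fun k => f k * phi k)).
  exact: measurable_int ifphi.
move/(ae_eq_integral_abs mu (measurable_itv _) mf) => [N [mN N0 subN]].
have : (mu I01 <= mu N)%E.
  apply: le_measure; rewrite ?inE//.
  move=> k k01; apply: subN => /= /(_ k01) [] E.
  by have := fphi0 _ k01; rewrite E ltxx.
by rewrite N0 lebesgue_measure_itv/= lte_fin ltr01 sube0 lee_fin ler10.
Qed.

(* Chebyshev's correlation inequality for [k] and [G], around the mean [t] of [k]. *)
Lemma wint_correlation e G : bounded_measurable e -> bounded_measurable G ->
  (forall k, I01 k -> 0 <= e k) -> 0 < wint e ->
  (forall k l, 0 <= k -> k <= l -> l <= 1 -> G k <= G l) ->
  wint (fun k => k * e k) * wint (fun k => G k * e k) <=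
  wint e * wint (fun k => k * (G k * e k)).
Proof.
move=> be bG e0 We nG.
have bid := bounded_measurable_id.
have bke : bounded_measurable (fun k => k * e k) by exact: bounded_measurableM.
have bGe : bounded_measurable (fun k => G k * e k) by exact: bounded_measurableM.
have bkGe : bounded_measurable (fun k => k * (G k * e k)) by exact: bounded_measurableM.
set W1 := wint (fun k => k * e k).
pose t := W1 / wint e.
have tE : t * wint e = W1 by rewrite /t divfK// gt_eqF.
have W10 : 0 <= W1.
  apply: wint_ge0 => k k01; rewrite mulr_ge0 ?e0//.
  by move: k01; rewrite /= in_itv/= => /andP[/ltW].
have W1W : W1 <= wint e.
  apply: le_wint => // k k01; rewrite ler_piMl ?e0//.
  by move: k01; rewrite /= in_itv/= => /andP[_ /ltW].
have t0 : 0 <= t by rewrite divr_ge0// ltW.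
have t1 : t <= 1 by rewrite ler_pdivrMr// mul1r.
suff : t * wint (fun k => G k * e k) <= wint (fun k => k * (G k * e k)).
  by rewrite -(ler_pM2l We) mulrA [wint e * t]mulrC tE.
(* This is (k - t) (G k - G t) e(k) >= 0 expanded. The terms with G t integrate to 0 since t is the
   mean. *)
have key k : I01 k ->
    G t * (k * e k) - G t * t * e k <= k * (G k * e k) - t * (G k * e k).
  move=> k01; have ek := e0 _ k01; move: k01; rewrite /= in_itv/= => /andP[k0 k1].
  rewrite -subr_ge0 (_ : _ - _ = (k - t) * (G k - G t) * e k); last by ring.
  apply: mulr_ge0 => //; have [kt|tk] := leP k t.
    by apply: mulr_le0; rewrite subr_le0// nG// ltW.
  by apply: mulr_ge0; rewrite subr_ge0 ?nG// ltW.
have bZ f c : bounded_measurable f -> bounded_measurable (fun k => c * f k).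
  by move=> bf; apply: bounded_measurableM => //; exact: bounded_measurable_cst.
have := le_wint (bounded_measurableB (bZ _ (G t) bke) (bZ _ (G t * t) be))
  (bounded_measurableB bkGe (bZ _ t bGe)) key.
rewrite !wintB ?wintZ//; try exact: bZ.
by rewrite -/W1 -mulrA tE subrr subr_ge0.
Qed.

End weighted_integral.

(** * Exponential moments *)

Section exponential_moments.
Context {R : realType}.
Local Notation mu := (@lebesgue_measure R).
Local Notation I01 := (`]0%R, 1%R[%classic : set R).

Lemma bounded_measurableX j : bounded_measurable (fun k : R => k ^+ j).
Proof.
elim: j => [|j IHj]; first exact: bounded_measurable_cst.
apply: (bounded_measurable_eq (f := fun k => k * k ^+ j)).
  by move=> k _; rewrite exprS.
by apply: bounded_measurableM => //; exact: bounded_measurable_id.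
Qed.

Lemma bounded_measurable_continuous (f : R -> R) C :
  (forall k, I01 k -> {for k, continuous f}) -> (forall k, I01 k -> `|f k| <= C) ->
  bounded_measurable f.
Proof.
move=> cf fC; split; last by exists C.
apply: open_continuous_measurable_fun; first exact: interval_open.
by move=> k; rewrite inE; exact: cf.
Qed.

Variable phi : R -> R.
Hypothesis phi_gt0 : forall k, I01 k -> 0 < phi k.
Hypothesis int_phi : mu.-integrable I01 (EFin \o phi).
Local Notation W := (wint phi).

Definition wmoment j (s : R) := W (fun k => k ^+ j * expR (- (s / 2 * k))).

Lemma bounded_measurable_moment j s :
  bounded_measurable (fun k : R => k ^+ j * expR (- (s / 2 * k))).
Proof.
apply: bounded_measurableM; first exact: bounded_measurableX.
exact: bounded_measurable_expR.
Qed.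

Lemma wmoment_gt0 j s : 0 < wmoment j s.
Proof.
apply: (wint_gt0 phi_gt0 int_phi) => [|k]; first exact: bounded_measurable_moment.
by rewrite /= in_itv/= => /andP[k0 _]; rewrite mulr_gt0 ?exprn_gt0 ?expR_gt0.
Qed.

Lemma wmomentS_le j s : wmoment j.+1 s <= wmoment j s.
Proof.
apply: (le_wint phi_gt0 int_phi); try exact: bounded_measurable_moment.
move=> k; rewrite /= in_itv/= => /andP[k0 k1].
rewrite exprS -mulrA ler_piMl ?(ltW k1)// mulr_ge0 ?expR_ge0//.
by rewrite exprn_ge0// ltW.
Qed.

(** The correlation inequality with G the identity; it gives the sign of [wratio']. *)
Lemma wmoment_logconvex s : wmoment 1 s ^+ 2 <= wmoment 0 s * wmoment 2 s.
Proof.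
have be : bounded_measurable (fun k => expR (- (s / 2 * k))).
  exact: bounded_measurable_expR.
have We : W (fun k => expR (- (s / 2 * k))) = wmoment 0 s.
  by apply: wint_eq => k _; rewrite expr0 mul1r.
have := @wint_correlation _ _ phi_gt0 int_phi _ id be (@bounded_measurable_id R).
have -> : W (fun k => k * expR (- (s / 2 * k))) = wmoment 1 s.
  by apply: wint_eq => k _; rewrite expr1.
have -> : W (fun k => k * (id k * expR (- (s / 2 * k)))) = wmoment 2 s.
  by apply: wint_eq => k _; rewrite expr2 mulrA.
rewrite We expr2; apply => //; exact: wmoment_gt0.
Qed.

Lemma is_derive_wmoment j (s : R) :
  is_derive s 1 (wmoment j) (- 2^-1 * wmoment j.+1 s).
Proof.
pose f (x k : R) := k ^+ j * expR (- (x / 2 * k)) * phi k.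
(* Uniform bound for the derivative on the window ]s - 1, s + 1[: there |x k / 2| <= (|s| + 1)/2,
   and the powers of k are at most 1. *)
pose G (k : R) := expR ((`|s| + 1) / 2) * `|phi k|.
have df (x k : R) : is_derive x 1 (f ^~ k)
    (- 2^-1 * (k ^+ j.+1 * expR (- (x / 2 * k)) * phi k)).
  rewrite (_ : f ^~ k = fun x => (k ^+ j * phi k) * expR (- ((k / 2) * x)));
    last first.
    by apply/funext => t; rewrite /f (_ : k / 2 * t = t / 2 * k);
      [ring|field].
  have did : is_derive x 1 (fun x : R => x) 1 by exact: is_derive_id.
  have := is_derive_mulcst (k ^+ j * phi k)
    (is_derive_expRfun (is_derive_oppfun (is_derive_mulcst (k / 2) did))).
  move/is_derive_eq; apply; rewrite (_ : k / 2 * x = x / 2 * k); last by field.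
  by rewrite exprS; field.
have Is : `]s - 1, s + 1[%classic s by rewrite /= in_itv/=; lra.
have intf x : `]s - 1, s + 1[%classic x -> mu.-integrable I01 (EFin \o f x).
  move=> _; apply: (integrable_weight int_phi).
  exact: bounded_measurable_moment.
have derf x k : `]s - 1, s + 1[%classic x -> I01 k -> derivable (f ^~ k) x 1.
  by move=> _ _; exact: ex_derive.
have G0 k : 0 <= G k by rewrite mulr_ge0// expR_ge0.
have intG : mu.-integrable I01 (EFin \o G).
  have iphi : mu.-integrable I01 (fun k => `|(phi k)%:E|)%E.
    exact: integrable_abse int_phi.
  rewrite (_ : EFin \o G = fun k =>
      ((expR ((`|s| + 1) / 2))%:E * `|(phi k)%:E|)%E)//.
  by apply: integrableZl => //; exact: measurable_itv.
have dE x k : partial1of2 f x k =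
    - 2^-1 * (k ^+ j.+1 * expR (- (x / 2 * k)) * phi k).
  by rewrite partial1of2E; have dfx := df x k; rewrite derive_val.
have Gub x k : `]s - 1, s + 1[%classic x -> I01 k -> `|partial1of2 f x k| <= G k.
  rewrite /= !in_itv/= => /andP[x0 x1] /andP[k0 k1]; rewrite dE /G !normrM mulrA.
  apply: ler_wpM2r => //; rewrite normrN [`|2^-1|]ger0_norm ?invr_ge0//.
  rewrite [`|k ^+ _|]ger0_norm ?exprn_ge0 ?(ltW k0)// (ger0_norm (expR_ge0 _)).
  have kj : k ^+ j.+1 <= 1 by rewrite exprn_ile1// ltW.
  have kj0 : 0 <= k ^+ j.+1 by rewrite exprn_ge0// ltW.
  have ele : expR (- (x / 2 * k)) <= expR ((`|s| + 1) / 2).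
    rewrite ler_expR; apply: (@le_trans _ _ (`|x| / 2)).
      apply: (le_trans (ler_norm _)).
      rewrite normrN !normrM [`|2^-1|]ger0_norm ?invr_ge0// (ger0_norm (ltW k0)).
      by rewrite ler_piMr ?(ltW k1)// mulr_ge0// invr_ge0.
    rewrite ler_pM2r ?invr_gt0//.
    have : `|x| <= `|s| + `|x - s| by rewrite -{1}(subrKC s x) ler_normD.
    have : `|x - s| <= 1 by rewrite ler_norml; lra.
    by lra.
  have e0 := expR_ge0 (- (x / 2 * k)).
  have ve : k ^+ j.+1 * expR (- (x / 2 * k)) <= expR (- (x / 2 * k)).
    by rewrite ler_piMl.
  apply: (le_trans _ (le_trans ve ele)); rewrite ler_piMl//; first exact: mulr_ge0.
  by rewrite invf_le1// ler1n.
have D := @derivable_under_integral R _ (measurableTypeR R) mu f I01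
  (measurable_itv _) s (s - 1) (s + 1) Is intf derf G G0 intG Gub.
have E := @differentiation_under_integral R _ (measurableTypeR R) mu f I01
  (measurable_itv _) s (s - 1) (s + 1) Is intf derf G G0 intG Gub.
apply: DeriveDef; first exact: D.
rewrite -derive1E.
transitivity (\int[mu]_(k in I01) (partial1of2 f)^~ k s)%R; first exact: E.
rewrite /wmoment /wint -RintegralZl//.
- by apply: eq_Rintegral => k _; exact: dE.
- by apply: (integrable_weight int_phi); exact: bounded_measurable_moment.
Qed.

Definition wratio (s : R) := wmoment 1 s / wmoment 0 s.

(** Minus half the variance of k under the normalized weight exp(-s k / 2) phi(k). *)
Definition wratio' (s : R) :=
  - 2^-1 * (wmoment 2 s * wmoment 0 s - wmoment 1 s ^+ 2) / wmoment 0 s ^+ 2.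

Lemma is_derive_wratio (s : R) : is_derive s 1 wratio (wratio' s).
Proof.
have M0 : wmoment 0 s != 0 by rewrite gt_eqF// wmoment_gt0.
have dV : is_derive s 1 (fun t => (wmoment 0 t)^-1)
    (- wmoment 0 s ^- 2 * (- 2^-1 * wmoment 1 s)).
  by apply: (is_deriveV M0); exact: is_derive_wmoment.
have := is_derive_mulfun (is_derive_wmoment 1 s) dV.
by move/is_derive_eq; apply; rewrite /wratio'; field.
Qed.

Lemma continuous_wratio' : continuous wratio'.
Proof.
have cM j : continuous (wmoment j).
  by move=> s; exact: is_derive_continuous (is_derive_wmoment j s).
move=> s; apply: cvgM.
  apply: cvgM; first exact: cvg_cst.
  apply: cvgB; first by apply: cvgM; exact: cM.
  by under eq_fun do rewrite expr2; rewrite expr2; apply: cvgM; exact: cM.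
apply: cvgV; first by rewrite expf_neq0// gt_eqF// wmoment_gt0.
by under eq_fun do rewrite expr2; rewrite expr2; apply: cvgM; exact: cM.
Qed.

Lemma wratio_ge0_le1 s : 0 <= wratio s <= 1.
Proof.
have M0 := wmoment_gt0 0 s; have M1 := wmoment_gt0 1 s.
apply/andP; split; first by rewrite divr_ge0// ltW.
by rewrite ler_pdivrMr// mul1r wmomentS_le.
Qed.

Lemma wratio'_geN1_le0 s : -1 <= wratio' s <= 0.
Proof.
have M0 := wmoment_gt0 0 s; have M1 := wmoment_gt0 1 s; have M2 := wmoment_gt0 2 s.
have M10 := wmomentS_le 0 s; have M21 := wmomentS_le 1 s.
have M20 : wmoment 2 s * wmoment 0 s <= wmoment 0 s ^+ 2.
  by rewrite expr2 ler_wpM2r ?(ltW M0)//; exact: le_trans M21 M10.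
have := wmoment_logconvex s; have := sqr_ge0 (wmoment 1 s).
have : 0 < wmoment 0 s ^+ 2 by rewrite exprn_gt0.
rewrite /wratio' [wmoment 0 s * _]mulrC => Q0 S0 L.
by rewrite ler_pdivlMr// ler_pdivrMr// mul0r; apply/andP; split; lra.
Qed.

End exponential_moments.

(** * The differential inequality *)

Section differential_inequality.
Context {R : realType}.
Local Notation mu := (@lebesgue_measure R).
Local Notation I01 := (`]0%R, 1%R[%classic : set R).

(* With [q = n0 / M0], [r = n1 / M1] and [G = N0 / n0], the claim reduces to
   [p + (c - G) q - 2 (c + 1 + m - G) r / b >= 0] for [0 <= r <= q <= 1]; after
   bounding [q] it is affine in [r] and [cond] settles both end points. *)
Lemma shrinkage_algebra (p b c m G1 w M0 M1 M2 n0 n1 N0 N1 : R) :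
  0 < M0 -> 0 < M1 -> 0 < b < 1 -> 0 <= c -> 0 <= m -> 0 < n0 -> 0 <= n1 ->
  n1 <= M1 -> n0 <= M0 -> M0 * n1 <= M1 * n0 -> n1 * N0 <= n0 * N1 ->
  0 <= N0 -> N0 <= G1 * n0 ->
  b * (w * M2) <= (c + 1 + m) * n1 - N1 -> c * n0 - N0 <= w * M1 ->
  c < p - 2 ->
  0 <= p + c - (2 * c + 2 + 2 * m) / b + Num.min 0 (c + 2 - G1) ->
  2 * w * M2 * M0 <= p * M0 * M1 + w * M1 ^+ 2.
Proof.
move=> M00 M10 /andP[b0 b1] c0 m0 n00 n10 n1M n0M MnMn nNnN N00 NG wM2 wM1 cp cond.
pose q := n0 / M0; pose r := n1 / M1; pose G := N0 / n0.
have Eq : n0 = q * M0 by rewrite /q divfK// gt_eqF.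
have Er : n1 = r * M1 by rewrite /r divfK// gt_eqF.
have EG : N0 = G * n0 by rewrite /G divfK// gt_eqF.
have q1 : q <= 1 by rewrite ler_pdivrMr// mul1r.
have r1 : r <= 1 by rewrite ler_pdivrMr// mul1r.
have r0 : 0 <= r by rewrite divr_ge0// ltW.
have rq : r <= q.
  by rewrite /r /q ler_pdivrMr// mulrAC ler_pdivlMr// mulrC [n0 * _]mulrC.
have G0 : 0 <= G by rewrite divr_ge0// ltW.
have GG1 : G <= G1 by rewrite ler_pdivrMr.
have GN1 : G * n1 <= N1.
  by rewrite -(ler_pM2l n00) mulrA [n0 * G]mulrC -EG mulrC.
pose ib := b^-1.
have ib1 : 1 <= ib by rewrite /ib -[leLHS]invr1 lef_pV2 ?posrE ?ltr01// ltW.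
have bib : b * ib = 1 by rewrite mulfV// gt_eqF.
have condB : 0 <= p + c - (2 * c + 2 + 2 * m) * ib.
  by apply: le_trans cond _; rewrite gerDl ge_min lexx.
(* Needed at the end point r = 0 when G > c. If G1 <= c + 2 it follows from c < p - 2; otherwise
   from the second entry of the minimum, as (2c + 2 + 2m)/b >= 2c + 2. *)
have pcG : 0 <= p + c - G1.
  have [h|h] := leP 0 (c + 2 - G1); first by lra.
  have : 0 <= p + c - (2 * c + 2 + 2 * m) * ib + (c + 2 - G1).
    by apply: le_trans cond _; rewrite lerD2l ge_min lexx orbT.
  have : 2 * c + 2 <= (2 * c + 2 + 2 * m) * ib.
    have h1 : 2 * c + 2 <= 2 * c + 2 + 2 * m by lra.
    by apply: (le_trans h1); rewrite ler_peMr//; lra.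
  by lra.
clearbody q r G ib.
have bracket : 0 <= p + (c - G) * q - 2 * ib * (c + 1 + m - G) * r.
  (* The value of the bracket at q = r = 1. It exceeds the quantity of [condB] by G (2/b - 1) >=
     0. *)
  pose L := p + c - G - 2 * ib * (c + 1 + m - G).
  have L0 : 0 <= L.
    have : 0 <= G * (2 * ib - 1) by rewrite mulr_ge0//; lra.
    by rewrite /L; lra.
  have rL : 0 <= r * L by rewrite mulr_ge0.
  (* Replace q by r if G <= c and by 1 otherwise; the bracket is then at least r L + (1 - r) p,
     respectively r L + (1 - r) (p + c - G). *)
  have [cG|Gc] := leP G c.
    have : 0 <= (c - G) * (q - r) by rewrite mulr_ge0// subr_ge0.
    have : 0 <= (1 - r) * p by rewrite mulr_ge0 ?subr_ge0//; lra.
    by move: rL; rewrite /L; lra.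
  have : 0 <= (G - c) * (1 - q) by rewrite mulr_ge0// subr_ge0// ltW.
  have : 0 <= (1 - r) * (p + c - G) by rewrite mulr_ge0 ?subr_ge0//; lra.
  by move: rL; rewrite /L; lra.
have wM2' : 2 * w * M2 <= 2 * ib * (c + 1 + m - G) * r * M1.
  have -> : 2 * w * M2 = 2 * ib * (b * (w * M2)).
    rewrite (_ : 2 * ib * _ = 2 * (b * ib) * (w * M2)); last by ring.
    by rewrite bib; ring.
  rewrite (_ : 2 * ib * (c + 1 + m - G) * r * M1 =
    2 * ib * ((c + 1 + m - G) * n1)); last by rewrite Er; ring.
  apply: ler_wpM2l; first lra.
  by apply: (le_trans wM2); rewrite mulrBl; lra.
have wM1' : (c - G) * q * M0 <= w * M1.
  by apply: le_trans wM1; rewrite EG -mulrA -Eq mulrBl.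
have h1 := ler_wpM2r (ltW M00) wM2'.
have h2 := ler_wpM2r (ltW M10) wM1'.
have h3 := mulr_ge0 (mulr_ge0 (ltW M00) (ltW M10)) bracket.
by rewrite expr2; lra.
Qed.

Variables (phi H : R -> R) (b c : R).
Hypothesis phi_gt0 : forall k, I01 k -> 0 < phi k.
Hypothesis int_phi : mu.-integrable I01 (EFin \o phi).
Hypothesis b01 : 0 < b < 1.
Hypothesis bmH : bounded_measurable H.
Hypothesis cH : forall k, I01 k -> {for k, continuous H}.
Hypothesis dphi : forall k : R, I01 k ->
  is_derive k 1 phi (phi k * ((c - 1 + H k) / k + (1 - b) / (1 - k))).
(** Decay rates fitted to the boundary function k P(k) below, which carries k^2 phi(k) at 0 and,
    since E k <= w (1 - k), a factor 1 - k at 1. *)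
Hypothesis phi_at0 :
  phi n.+3%:R^-1 * n.+3%:R^-1 ^+ 2 @[n --> \oo] --> (0 : R).
Hypothesis phi_at1 :
  phi (1 - n.+3%:R^-1) * n.+3%:R^-1 @[n --> \oo] --> (0 : R).
Local Notation W := (wint phi).

(** * Integration by parts at a fixed w > 0 *)

Section fixed_parameter.
Variable w : R.
Hypothesis w_gt0 : 0 < w.
Let e k := expR (- (w * k)).
Let E k := 1 - expR (- (w * (1 - k))).
Let T k := E k / (1 - k).

Let k01P k : I01 k -> 0 < k /\ k < 1.
Proof. by rewrite /= in_itv/= => /andP. Qed.

Let be : bounded_measurable e. Proof. exact: bounded_measurable_expR. Qed.

Let e_gt0 k : 0 < e k. Proof. exact: expR_gt0. Qed.

Let e_le1 k : 0 <= k -> e k <= 1.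
Proof. by move=> k0; rewrite -expR0 ler_expR oppr_le0 mulr_ge0// ltW. Qed.

Let E_ge0 k : k <= 1 -> 0 <= E k.
Proof.
by move=> k1; rewrite /E subr_ge0 -[leRHS]expR0 ler_expR oppr_le0 mulr_ge0 ?subr_ge0// ltW.
Qed.

Let E_gt0 k : k < 1 -> 0 < E k.
Proof.
by move=> k1; rewrite /E subr_gt0 -[ltRHS]expR0 ltr_expR oppr_lt0 mulr_gt0 ?subr_gt0.
Qed.

Let E_le1 k : E k <= 1.
Proof. by rewrite gerBl expR_ge0. Qed.

Let E_le k : E k <= w * (1 - k).
Proof. by have := expR_ge1Dx (- (w * (1 - k))); rewrite /E; lra. Qed.

Let E_noninc k l : k <= l -> E l <= E k.
Proof.
move=> kl; rewrite lerD2l lerN2 ler_expR lerN2.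
by apply: ler_wpM2l; [exact: ltW|rewrite lerD2l lerN2].
Qed.

Let ce : continuous e.
Proof.
by move=> k; apply: continuous_comp; [apply: cvgN; apply: cvgM;
  [exact: cvg_cst|exact: cvg_id]|exact: continuous_expR].
Qed.

Let cE : continuous E.
Proof.
move=> k; apply: cvgB; first exact: cvg_cst.
apply: continuous_comp; last exact: continuous_expR.
apply: cvgN; apply: cvgM; first exact: cvg_cst.
by apply: cvgB; [exact: cvg_cst|exact: cvg_id].
Qed.

Let cT k : I01 k -> {for k, continuous T}.
Proof.
move=> /k01P[_ k1]; apply: cvgM; first exact: cE.
apply: cvgV; first by rewrite gt_eqF// subr_gt0.
by apply: cvgB; [exact: cvg_cst|exact: cvg_id].
Qed.

Let T_ge0 k : I01 k -> 0 <= T k.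
Proof. by move=> /k01P[_ k1]; rewrite divr_ge0 ?E_ge0 ?subr_ge0 ?ltW. Qed.

Let T_le k : I01 k -> T k <= w.
Proof. by move=> /k01P[_ k1]; rewrite ler_pdivrMr ?E_le ?subr_gt0. Qed.

Let bE : bounded_measurable E.
Proof.
apply: (@bounded_measurable_continuous _ _ 1) => [k _|k /k01P[_ k1]]; first exact: cE.
by rewrite ger0_norm ?E_le1// E_ge0// ltW.
Qed.

Let bT : bounded_measurable T.
Proof.
apply: (@bounded_measurable_continuous _ _ w) => [k|k k01]; first exact: cT.
by rewrite ger0_norm ?T_ge0 ?T_le.
Qed.

Let bEe : bounded_measurable (fun k => E k * e k).
Proof. exact: bounded_measurableM. Qed.

Let cphi k : I01 k -> {for k, continuous phi}.
Proof. by move=> k01; exact: is_derive_continuous (dphi k01). Qed.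

(** The factor k cancels the pole of the logarithmic derivative of phi at 0, and e k - expR (- w) =
    E k e k the one at 1. *)
Let P k := k * (phi k * (e k - expR (- w))).

Let PE k : P k = k * (phi k * (E k * e k)).
Proof.
rewrite /P; congr (_ * (_ * _)); rewrite /E mulrBl mul1r; congr (_ - _).
by rewrite /e -expRD; congr expR; ring.
Qed.

(** The derivatives of P and of k P(k) are u0 phi and u1 phi. Written with T they have visibly
    bounded multipliers, hence are integrable. *)
Let u0 k := (c + H k) * (E k * e k) + (1 - b) * (k * (T k * e k)) - w * (k * e k).
Let u1 k := k * ((c + 1 + H k) * (E k * e k)) + (1 - b) * (k * (k * (T k * e k)))
  - w * (k * (k * e k)).

Let is_derive_e (k : R) : is_derive k 1 e (- w * e k).
Proof.
have did : is_derive k 1 (fun x : R => x) 1 by exact: is_derive_id.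
have := is_derive_expRfun (is_derive_oppfun (is_derive_mulcst w did)).
by move/is_derive_eq; apply; rewrite /e; ring.
Qed.

Let is_derive_P (k : R) : I01 k -> is_derive k 1 P (u0 k * phi k).
Proof.
move=> k01; have [k0 k1] := k01P k01.
have did : is_derive k 1 (fun x : R => x) 1 by exact: is_derive_id.
have := is_derive_mulfun did (is_derive_mulfun (dphi k01)
  (is_derive_addfun (is_derive_e k) (is_derive_cst (- expR (- w)) k 1))).
have -> : e k - expR (- w) = E k * e k.
  have := PE k; rewrite /P; have kphi : k * phi k != 0.
    by rewrite mulf_neq0// gt_eqF// phi_gt0.
  by rewrite !mulrA -(mulrA (k * phi k)) => /(mulfI kphi).
move/is_derive_eq; apply; rewrite /u0 /T.
by field; rewrite !gt_eqF ?subr_gt0.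
Qed.

Let is_derive_kP (k : R) : I01 k -> is_derive k 1 (fun k => k * P k) (u1 k * phi k).
Proof.
move=> k01; have did : is_derive k 1 (fun x : R => x) 1 by exact: is_derive_id.
have := is_derive_mulfun did (is_derive_P k01).
by move/is_derive_eq; apply; rewrite PE /u0 /u1; ring.
Qed.

Let bkf (f : R -> R) : bounded_measurable f -> bounded_measurable (fun k => k * f k).
Proof. by move=> bf; apply: bounded_measurableM => //; exact: bounded_measurable_id. Qed.

Let bZ (a : R) (f : R -> R) : bounded_measurable f -> bounded_measurable (fun k => a * f k).
Proof. by move=> bf; apply: bounded_measurableM => //; exact: bounded_measurable_cst. Qed.

Let bcH (a : R) : bounded_measurable (fun k => a + H k).
Proof. by apply: bounded_measurableD => //; exact: bounded_measurable_cst. Qed.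

Let bTe : bounded_measurable (fun k => T k * e k).
Proof. exact: bounded_measurableM. Qed.

Let bHEe (a : R) : bounded_measurable (fun k => (a + H k) * (E k * e k)).
Proof. exact: bounded_measurableM. Qed.

Let bu0 : bounded_measurable u0.
Proof.
apply: bounded_measurableB; last by apply: bZ; exact: bkf.
by apply: bounded_measurableD => //; apply: bZ; exact: bkf.
Qed.

Let bu1 : bounded_measurable u1.
Proof.
apply: bounded_measurableB; last by apply: bZ; do 2 apply: bkf.
by apply: bounded_measurableD; [exact: bkf|apply: bZ; do 2 apply: bkf].
Qed.

Let cvgk (f : R -> R) (k : R) : {for k, continuous f} ->
  {for k, continuous (fun k : R => k * f k)}.
Proof. by move=> cf; apply: cvgM; [exact: cvg_id|exact: cf]. Qed.

Let cZ (a : R) (f : R -> R) (k : R) : {for k, continuous f} ->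
  {for k, continuous (fun k : R => a * f k)}.
Proof. by move=> cf; apply: cvgM; [exact: cvg_cst|exact: cf]. Qed.

Let cTe k : I01 k -> {for k, continuous (fun k : R => T k * e k)}.
Proof. by move=> k01; apply: cvgM; [exact: cT|exact: ce]. Qed.

Let cHEe (a : R) k : I01 k -> {for k, continuous (fun k : R => (a + H k) * (E k * e k))}.
Proof.
move=> k01; apply: cvgM; last by apply: cvgM; [exact: cE|exact: ce].
by apply: cvgD; [exact: cvg_cst|exact: cH].
Qed.

Let cBf (f g : R -> R) (k : R) : {for k, continuous f} -> {for k, continuous g} ->
  {for k, continuous (fun k : R => f k - g k)}.
Proof. by move=> cf cg; exact: cvgB. Qed.

Let cDf (f g : R -> R) (k : R) : {for k, continuous f} -> {for k, continuous g} ->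
  {for k, continuous (fun k : R => f k + g k)}.
Proof. by move=> cf cg; exact: cvgD. Qed.

Let cMf (f g : R -> R) (k : R) : {for k, continuous f} -> {for k, continuous g} ->
  {for k, continuous (fun k : R => f k * g k)}.
Proof. by move=> cf cg; exact: cvgM. Qed.

Let cu0phi k : I01 k -> {for k, continuous (fun k : R => u0 k * phi k)}.
Proof.
move=> k01.
have h1 : {for k, continuous (fun k : R => k * (T k * e k))}.
  exact: cvgk (cTe k01).
have h2 : {for k, continuous (fun k : R => (1 - b) * (k * (T k * e k)))}.
  exact: cZ h1.
have cek : {for k, continuous e} by exact: ce.
have h3 : {for k, continuous (fun k : R => k * e k)} by exact: cvgk cek.
have h4 : {for k, continuous (fun k : R => w * (k * e k))} by exact: cZ h3.
have h5 : {for k, continuous (fun k : R =>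
    (c + H k) * (E k * e k) + (1 - b) * (k * (T k * e k)))}.
  have h0 : {for k, continuous (fun k : R => (c + H k) * (E k * e k))}.
    exact: cHEe.
  exact: (@cDf (fun k => (c + H k) * (E k * e k))
    (fun k => (1 - b) * (k * (T k * e k))) k h0 h2).
have h6 : {for k, continuous u0} by exact: cBf h5 h4.
exact: cMf h6 (cphi k01).
Qed.

Let cu1phi k : I01 k -> {for k, continuous (fun k : R => u1 k * phi k)}.
Proof.
move=> k01.
have h1 : {for k, continuous (fun k : R => k * (T k * e k))}.
  exact: cvgk (cTe k01).
have h1' : {for k, continuous (fun k : R => k * (k * (T k * e k)))}.
  exact: cvgk h1.
have h2 : {for k, continuous (fun k : R => (1 - b) * (k * (k * (T k * e k))))}.
  exact: cZ h1'.
have cek : {for k, continuous e} by exact: ce.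
have h3 : {for k, continuous (fun k : R => k * e k)} by exact: cvgk cek.
have h3' : {for k, continuous (fun k : R => k * (k * e k))} by exact: cvgk h3.
have h4 : {for k, continuous (fun k : R => w * (k * (k * e k)))} by exact: cZ h3'.
have h5 : {for k, continuous (fun k : R => k * ((c + 1 + H k) * (E k * e k)))}.
  have h0 : {for k, continuous (fun k : R => (c + 1 + H k) * (E k * e k))}.
    exact: cHEe.
  exact: (@cvgk (fun k => (c + 1 + H k) * (E k * e k)) k h0).
have h6 : {for k, continuous (fun k : R =>
    k * ((c + 1 + H k) * (E k * e k)) + (1 - b) * (k * (k * (T k * e k))))}.
  exact: (@cDf (fun k => k * ((c + 1 + H k) * (E k * e k)))
    (fun k => (1 - b) * (k * (k * (T k * e k)))) k h5 h2).
have h7 : {for k, continuous u1} by exact: cBf h6 h4.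
exact: cMf h7 (cphi k01).
Qed.

Let x (n : nat) : R := n.+3%:R^-1.

Let x01 n : 0 < x n < 1.
Proof.
rewrite /x invr_gt0 ltr0n/= -[ltRHS]invr1 ltf_pV2 ?posrE ?ltr0n ?ltr01//.
by rewrite ltr1n.
Qed.

Let P_ge0 k : I01 k -> 0 <= P k.
Proof.
move=> k01; have [k0 k1] := k01P k01; rewrite PE.
rewrite mulr_ge0 ?(ltW k0)// mulr_ge0 ?(ltW (phi_gt0 k01))//.
by rewrite mulr_ge0 ?E_ge0 ?ltW.
Qed.

Let P_le1 n : P (1 - x n) <= w * (phi (1 - x n) * x n).
Proof.
have /andP[x0 x1] := x01 n.
have y01 : I01 (1 - x n) by rewrite /= in_itv/=; apply/andP; split; lra.
have p0 := phi_gt0 y01.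
have Ey : E (1 - x n) <= w * x n by have := E_le (1 - x n); rewrite subKr.
have Ey0 : 0 <= E (1 - x n) by apply: E_ge0; lra.
rewrite PE; apply: (@le_trans _ _ (phi (1 - x n) * (w * x n))); last first.
  by rewrite mulrCA.
apply: (@le_trans _ _ (phi (1 - x n) * (E (1 - x n) * e (1 - x n)))).
  apply: ler_piMl; last by lra.
  by rewrite mulr_ge0 ?(ltW p0)// mulr_ge0// ltW.
apply: ler_wpM2l; first exact: ltW.
by apply: le_trans Ey; apply: ler_piMr => //; apply: e_le1; lra.
Qed.

Let kP_le0 n : x n * P (x n) <= phi (x n) * x n ^+ 2.
Proof.
have /andP[x0 x1] := x01 n.
have x01' : I01 (x n) by rewrite /= in_itv/= x0 x1.
have p0 := phi_gt0 x01'.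
rewrite PE (_ : x n * _ = phi (x n) * x n ^+ 2 * (E (x n) * e (x n))); last by ring.
apply: ler_piMr; first by rewrite mulr_ge0 ?(ltW p0)// exprn_ge0// ltW.
rewrite -[leRHS]mulr1; apply: ler_pM => //; [|exact: ltW|].
  by apply: E_ge0; exact: ltW.
by apply: e_le1; exact: ltW.
Qed.

Let P_at1 : P (1 - x n) @[n --> \oo] --> 0.
Proof.
apply: (@squeeze_cvgr _ _ _ _ (cst 0) (fun n => w * (phi (1 - x n) * x n))).
- apply: nearW => n; rewrite P_le1 andbT; apply: P_ge0.
  by have /andP[x0 x1] := x01 n; rewrite /= in_itv/=; apply/andP; split; lra.
- exact: cvg_cst.
- by rewrite -[X in _ --> X](mulr0 w); apply: cvgMr; exact: phi_at1.
Qed.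

(** P tends to 0 at 1 and is nonnegative near 0, so its derivative has nonpositive integral; the
    term with T is nonnegative and is dropped. *)
Lemma wint_ibp0 : W (fun k => (c + H k) * (E k * e k)) <= w * W (fun k => k * e k).
Proof.
have := cvg_integral_exhausts exhausts_01 (integrable_weight int_phi bu0)
  is_derive_P cu0phi.
move=> cvgP; have := P_at1 => P1.
have : W u0 <= 0.
  apply: (ler_cvg_to cvgP P1); apply: nearW => n.
  rewrite gerBl; apply: P_ge0.
  by have /andP[x0 x1] := x01 n; rewrite /= in_itv/= x0.
rewrite /u0 wintB ?wintD ?wintZ//; first last.
- by apply: bZ; exact: bkf.
- by apply: bounded_measurableD => //; apply: bZ; exact: bkf.
- by apply: bZ; exact: bkf.
- exact: bkf.
- exact: bkf.
have : 0 <= (1 - b) * W (fun k => k * (T k * e k)).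
  apply: mulr_ge0; first by have /andP[_ b1] := b01; rewrite subr_ge0 ltW.
  apply: (wint_ge0 phi_gt0) => k k01; have [k0 _] := k01P k01.
  by rewrite mulr_ge0 ?(ltW k0)// mulr_ge0 ?T_ge0// ltW.
lra.
Qed.

(** k P(k) vanishes at both ends, which gives an equality. Bounding T by w there and moving (1 - b)
    w M_2 to the left produces the factor b. *)
Lemma wint_ibp1 : b * (w * W (fun k => k * (k * e k))) <=
  W (fun k => k * ((c + 1 + H k) * (E k * e k))).
Proof.
have := cvg_integral_exhausts exhausts_01 (integrable_weight int_phi bu1)
  is_derive_kP cu1phi.
move=> cvgkP.
have Q1 : (1 - x n) * P (1 - x n) @[n --> \oo] --> 0.
  apply: (@squeeze_cvgr _ _ _ _ (cst 0) (fun n => P (1 - x n))) => //.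
    apply: nearW => n; have /andP[x0 x1] := x01 n.
    have Pn : 0 <= P (1 - x n).
      by apply: P_ge0; rewrite /= in_itv/=; apply/andP; split; lra.
    by apply/andP; split; [rewrite mulr_ge0//; lra|rewrite ler_piMl//; lra].
  exact: cvg_cst.
have Q0 : x n * P (x n) @[n --> \oo] --> 0.
  apply: (@squeeze_cvgr _ _ _ _ (cst 0) (fun n => phi (x n) * x n ^+ 2)) => //.
    apply: nearW => n; rewrite kP_le0 andbT; have /andP[x0 x1] := x01 n.
    by rewrite mulr_ge0 ?(ltW x0)//; apply: P_ge0; rewrite /= in_itv/= x0.
  exact: cvg_cst.
have Q : (1 - x n) * P (1 - x n) - x n * P (x n) @[n --> \oo] --> 0.
  by rewrite -[X in _ --> X](subrr 0); apply: cvgB.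
have : W u1 = 0 by exact: (cvg_unique _ cvgkP Q).
rewrite /u1 wintB ?wintD ?wintZ//; first last.
- by apply: bZ; do 2 apply: bkf.
- by apply: bounded_measurableD; [exact: bkf|apply: bZ; do 2 apply: bkf].
- by apply: bZ; do 2 apply: bkf.
- exact: bkf.
- by do 2 apply: bkf.
- by do 2 apply: bkf.
have : (1 - b) * W (fun k => k * (k * (T k * e k))) <=
    (1 - b) * (w * W (fun k => k * (k * e k))).
  apply: ler_wpM2l; first by have /andP[_ b1] := b01; rewrite subr_ge0 ltW.
  rewrite -wintZ//; last by do 2 apply: bkf.
  apply: (le_wint phi_gt0 int_phi); [by do 2 apply: bkf|by apply: bZ; do 2 apply: bkf|].
  move=> k k01; have [k0 _] := k01P k01.
  rewrite (_ : w * _ = k * (k * (w * e k))); last by ring.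
  do 2 (apply: ler_wpM2l; first exact: ltW).
  by apply: ler_wpM2r; [exact: ltW|exact: T_le].
lra.
Qed.

Lemma wint_shrinkage_inequality (p m G1 : R) (g : R -> R) :
  bounded_measurable g -> (forall k l, 0 <= k -> k <= l -> l <= 1 -> g k <= g l) ->
  (forall k, I01 k -> 0 <= g k <= G1) ->
  (forall k, I01 k -> 0 <= H k + g k <= m) ->
  0 <= c -> 0 <= m -> c < p - 2 ->
  0 <= p + c - (2 * c + 2 + 2 * m) / b + Num.min 0 (c + 2 - G1) ->
  2 * w * W (fun k => k * (k * e k)) * W e <=
    p * W e * W (fun k => k * e k) + w * W (fun k => k * e k) ^+ 2.
Proof.
move=> bg ng g01 Hg c0 m0 cp cond.
have bgEe : bounded_measurable (fun k => g k * (E k * e k)) by exact: bounded_measurableM.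
have We0 : 0 < W e by apply: (wint_gt0 phi_gt0 int_phi).
have WEe0 : 0 < W (fun k => E k * e k).
  apply: (wint_gt0 phi_gt0 int_phi) => // k /k01P[_ k1].
  by rewrite mulr_gt0 ?E_gt0.
have Ee0 k : I01 k -> 0 <= E k * e k.
  by move=> /k01P[_ k1]; rewrite mulr_ge0 ?E_ge0 ?ltW.
have Ee_le k : I01 k -> E k * e k <= e k.
  by move=> k01; rewrite ler_piMl ?E_le1// ltW.
apply: (@shrinkage_algebra p b c m G1 w (W e) (W (fun k => k * e k)) _
  (W (fun k => E k * e k)) (W (fun k => k * (E k * e k)))
  (W (fun k => g k * (E k * e k))) (W (fun k => k * (g k * (E k * e k))))) => //.
- apply: (wint_gt0 phi_gt0 int_phi); first exact: bkf.
  by move=> k /k01P[k0 _]; rewrite mulr_gt0.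
- apply: (wint_ge0 phi_gt0) => k k01; have [k0 _] := k01P k01.
  by rewrite mulr_ge0 ?(ltW k0)// Ee0.
- apply: (le_wint phi_gt0 int_phi); [exact: bkf|exact: bkf|].
  by move=> k k01; have [k0 _] := k01P k01; rewrite ler_wpM2l ?(ltW k0)// Ee_le.
- exact: (le_wint phi_gt0 int_phi).
(* E is nonincreasing, so the correlation inequality is applied to -E under the weight e phi. *)
- have bNE : bounded_measurable (fun k => - 1 * E k) by exact: bZ.
  have := @wint_correlation _ _ phi_gt0 int_phi e (fun k => - 1 * E k) be bNE.
  have -> : W (fun k => - 1 * E k * e k) = - W (fun k => E k * e k).
    rewrite -[RHS]mulN1r -wintZ//.
    by apply: wint_eq => k _; rewrite mulrA.
  have -> : W (fun k => k * (- 1 * E k * e k)) = - W (fun k => k * (E k * e k)).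
    rewrite -[RHS]mulN1r -wintZ//; last exact: bkf.
    by apply: wint_eq => k _; ring.
  rewrite !mulrN lerN2; apply => //.
    by move=> k _; exact: ltW.
  by move=> k l _ kl _; rewrite !mulN1r lerN2 E_noninc.
(* Here the weight is E e phi and the monotone function is g, the role later played by -H_1. *)
- exact: (@wint_correlation _ _ phi_gt0 int_phi (fun k => E k * e k) g bEe bg).
- apply: (wint_ge0 phi_gt0) => k k01; have /andP[g0 _] := g01 _ k01.
  by rewrite mulr_ge0// Ee0.
- rewrite -wintZ//; apply: (le_wint phi_gt0 int_phi) => //; first exact: bZ.
  by move=> k k01; have /andP[_ g1] := g01 _ k01; rewrite ler_wpM2r// Ee0.
- apply: (le_trans wint_ibp1).
  rewrite -wintZ//; last exact: bkf.
  rewrite -wintB//; [|by apply: bZ; exact: bkf|exact: bkf].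
  apply: (le_wint phi_gt0 int_phi); first exact: bkf.
    by apply: bounded_measurableB; [by apply: bZ; exact: bkf|exact: bkf].
  move=> k k01; have [k0 _] := k01P k01; have /andP[_ Hm] := Hg _ k01.
  rewrite (_ : _ - _ = k * ((c + 1 + m - g k) * (E k * e k))); last by ring.
  apply: ler_wpM2l; first exact: ltW.
  by apply: ler_wpM2r; [exact: Ee0|lra].
- apply: le_trans wint_ibp0.
  rewrite -wintZ// -wintB//; last exact: bZ.
  apply: (le_wint phi_gt0 int_phi) => //; first by apply: bounded_measurableB => //; exact: bZ.
  move=> k k01; have /andP[Hm _] := Hg _ k01.
  by rewrite -mulrBl ler_wpM2r ?Ee0//; lra.
Qed.

End fixed_parameter.

Lemma wratio_differential_inequality (p m G1 : R) (g : R -> R) :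
  bounded_measurable g -> (forall k l, 0 <= k -> k <= l -> l <= 1 -> g k <= g l) ->
  (forall k, I01 k -> 0 <= g k <= G1) ->
  (forall k, I01 k -> 0 <= H k + g k <= m) ->
  0 <= c -> 0 <= m -> c < p - 2 ->
  0 <= p + c - (2 * c + 2 + 2 * m) / b + Num.min 0 (c + 2 - G1) ->
  forall s, 0 <= s -> - 2 * p * wratio phi s - 4 * wratio' phi s * s +
    wratio phi s ^+ 2 * s <= 0.
Proof.
move=> bg ng g01 Hg c0 m0 cp cond s s0.
have M0 := wmoment_gt0 phi_gt0 int_phi 0 s.
have M1 := wmoment_gt0 phi_gt0 int_phi 1 s.
have key : s * wmoment phi 2 s * wmoment phi 0 s <=
    p * wmoment phi 0 s * wmoment phi 1 s + s / 2 * wmoment phi 1 s ^+ 2.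
  (* At s = 0 the claim is p M_0 M_1 >= 0; the integrations by parts require w > 0. *)
  move: s0; rewrite le_eqVlt => /predU1P[<-|s0].
    have p0 : 0 <= p by lra.
    rewrite mul0r mul0r mul0r mul0r addr0; apply: mulr_ge0.
      by apply: mulr_ge0 => //; apply: ltW; exact: wmoment_gt0.
    by apply: ltW; exact: wmoment_gt0.
  have w0 : 0 < s / 2 by rewrite divr_gt0.
  have := wint_shrinkage_inequality w0 bg ng g01 Hg c0 m0 cp cond.
  have -> : W (fun k => expR (- (s / 2 * k))) = wmoment phi 0 s.
    by apply: wint_eq => k _; rewrite expr0 mul1r.
  have -> : W (fun k => k * expR (- (s / 2 * k))) = wmoment phi 1 s.
    by apply: wint_eq => k _; rewrite expr1.
  have -> : W (fun k => k * (k * expR (- (s / 2 * k)))) = wmoment phi 2 s.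
    by apply: wint_eq => k _; rewrite expr2 mulrA.
  by rewrite (_ : 2 * (s / 2) = s)//; field.
have -> : - 2 * p * wratio phi s - 4 * wratio' phi s * s + wratio phi s ^+ 2 * s =
   2 * (s * wmoment phi 2 s * wmoment phi 0 s -
    (p * wmoment phi 0 s * wmoment phi 1 s + s / 2 * wmoment phi 1 s ^+ 2))
   / wmoment phi 0 s ^+ 2.
  by rewrite /wratio /wratio'; field; rewrite gt_eqF.
rewrite ler_pdivrMr ?exprn_gt0// mul0r.
by rewrite pmulr_rle0// subr_le0.
Qed.

End differential_inequality.

(** * Powers and the slowly varying factor *)

Section power_functions.
Context {R : realType}.
Local Notation mu := (@lebesgue_measure R).
Local Notation I01 := (`]0%R, 1%R[%classic : set R).

Lemma powR_pred (k r : R) : 0 < k -> k `^ (r - 1) = k `^ r / k.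
Proof.
move=> k0; rewrite powRD; last by rewrite (gt_eqF k0) implybT.
by rewrite powR_inv1// ltW.
Qed.

Lemma powR_noninc (r x y : R) : r <= 0 -> 0 < x -> x <= y -> y `^ r <= x `^ r.
Proof.
move=> r0 x0 xy; have y0 : 0 < y by exact: lt_le_trans xy.
rewrite -[r]opprK (powRN x) (powRN y) lef_pV2 ?posrE ?powR_gt0//.
by apply: ge0_ler_powR; rewrite ?nnegrE ?oppr_ge0// ltW.
Qed.

Lemma powR_le1 (r x : R) : 0 <= r -> 0 < x <= 1 -> x `^ r <= 1.
Proof. by move=> r0 x01; rewrite -[leRHS](powRr0 x); apply: ger_powR. Qed.

Lemma cvg_powR_invn (r : R) : 0 < r -> n.+3%:R^-1 `^ r @[n --> \oo] --> (0 : R).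
Proof.
move=> r0; apply/cvgrPdist_lt => e e0.
pose d := e `^ r^-1; have d0 : 0 < d by rewrite powR_gt0.
have [N dN] := natS_unbounded d^-1.
exists N => // n /= Nn; rewrite sub0r normrN ger0_norm ?powR_ge0//.
have -> : e = d `^ r by rewrite -powRrM mulVf ?gt_eqF// powRr1// ltW.
apply: gt0_ltr_powR => //; rewrite ?nnegrE ?invr_ge0 ?(ltW d0)//.
rewrite -[ltRHS]invrK ltf_pV2 ?posrE ?ltr0n ?invr_gt0//.
by apply: (le_lt_trans dN); rewrite ltr_nat !ltnS (leq_trans Nn).
Qed.

Lemma integrable_primitive (F f : R -> R) (K : R) :
  (forall k, I01 k -> 0 <= f k) -> (forall k : R, I01 k -> is_derive k 1 F (f k)) ->
  (forall k, I01 k -> {for k, continuous f}) ->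
  (forall k l, I01 k -> I01 l -> F l - F k <= K) ->
  mu.-integrable I01 (EFin \o f).
Proof.
move=> f0 dF cf FK.
have mf : measurable_fun I01 f.
  apply: open_continuous_measurable_fun; first exact: interval_open.
  by move=> k; rewrite inE; exact: cf.
apply/integrableP; split; first exact/measurable_EFinP.
apply: (@le_lt_trans _ _ K%:E); last exact: ltry.
rewrite [leLHS](_ : _ = \int[mu]_(k in I01) (f k)%:E)%E; last first.
  by apply: eq_integral => k /set_mem k01; rewrite /= ger0_norm// f0.
apply: (ge0_integral_exhausts_le exhausts_01 mf f0 dF cf) => n; apply: FK.
  apply: (exhausts_sub (n := n) exhausts_01); rewrite lexx/=.
  by have [_ _ /(_ n) /ltW] := @exhausts_01 R.
apply: (exhausts_sub (n := n) exhausts_01); rewrite lexx andbT.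
by have [_ _ /(_ n) /ltW] := @exhausts_01 R.
Qed.

Lemma continuous_powR_gt0 (r k : R) : 0 < k -> {for k, continuous (fun x => x `^ r)}.
Proof. by move=> k0; exact: is_derive_continuous (is_derive1_powR r k0). Qed.

Lemma is_derive_powR_onem (r k : R) : k < 1 ->
  is_derive k 1 (fun x => (1 - x) `^ r) (- (r * (1 - k) `^ (r - 1))).
Proof.
move=> k1; have d1 : is_derive k 1 (fun x : R => 1 - x) (-1).
  have did : is_derive k 1 (fun x : R => x) 1 by exact: is_derive_id.
  have := is_derive_addfun (is_derive_cst (1 : R) k 1) (is_derive_oppfun did).
  by move/is_derive_eq; apply; rewrite add0r.
have k1' : 0 < 1 - k by rewrite subr_gt0.
have := @is_derive1_comp _ (fun x => x `^ r) (fun x => 1 - x) k _ _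
    (is_derive1_powR r k1') d1.
by move/is_derive_eq; apply; rewrite mulrN1.
Qed.

Lemma integrable_powR (e : R) : 0 < e ->
  mu.-integrable I01 (EFin \o (fun k => k `^ (e - 1))).
Proof.
move=> e0; apply: (@integrable_primitive (fun k => e^-1 * k `^ e) _ e^-1).
- by move=> k _; exact: powR_ge0.
- move=> k; rewrite /= in_itv/= => /andP[k0 _].
  have := is_derive_mulcst e^-1 (is_derive1_powR e k0).
  by move/is_derive_eq; apply; rewrite mulKf ?gt_eqF.
- by move=> k; rewrite /= in_itv/= => /andP[k0 _]; exact: continuous_powR_gt0.
- move=> k l; rewrite /= !in_itv/= => /andP[k0 _] /andP[l0 l1].
  have ie0 : 0 < e^-1 by rewrite invr_gt0.
  have : 0 <= e^-1 * k `^ e by rewrite mulr_ge0 ?powR_ge0// ltW.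
  have : e^-1 * l `^ e <= e^-1.
    by rewrite ler_piMr ?(ltW ie0)// powR_le1 ?(ltW e0)// l0 ltW.
  lra.
Qed.

Lemma integrable_powR_onem (e : R) : 0 < e ->
  mu.-integrable I01 (EFin \o (fun k => (1 - k) `^ (e - 1))).
Proof.
move=> e0; apply: (@integrable_primitive (fun k => - e^-1 * (1 - k) `^ e) _ e^-1).
- by move=> k _; exact: powR_ge0.
- move=> k; rewrite /= in_itv/= => /andP[_ k1].
  have := is_derive_mulcst (- e^-1) (is_derive_powR_onem e k1).
  by move/is_derive_eq; apply; rewrite mulrNN mulKf ?gt_eqF.
- move=> k; rewrite /= in_itv/= => /andP[_ k1].
  exact: is_derive_continuous (is_derive_powR_onem (e - 1) k1).
- move=> k l; rewrite /= !in_itv/= => /andP[k0 k1] /andP[l0 l1].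
  have ie0 : 0 < e^-1 by rewrite invr_gt0.
  have : 0 <= e^-1 * (1 - l) `^ e by rewrite mulr_ge0 ?powR_ge0// ltW.
  have : e^-1 * (1 - k) `^ e <= e^-1.
    rewrite ler_piMr ?(ltW ie0)// powR_le1 ?(ltW e0)//; lra.
  lra.
Qed.

End power_functions.

(** * Bounds on h and H *)

Section slowly_varying_factor.
Context {R : realType}.
Variables h h' : R -> R.
Hypothesis h_gt0 : forall k, 0 < k <= 1 -> 0 < h k.
Hypothesis h_C1 : C1_on `]0, 1] h h'.
Hypothesis h_lim : k * (h' k / h k) @[k --> 0^'+] --> (0 : R).

Lemma C1_is_derive (k : R) : 0 < k < 1 -> is_derive k 1 h (h' k).
Proof.
move=> k01; have /andP[k0 k1] := k01.
have [/(_ k) + _] := h_C1.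
have kA : `]0, 1]%classic k by rewrite /= in_itv/= k0 ltW.
move=> /(_ kA) dh.
apply/is_derive1_caratheodory.
(* The difference quotient completed by its limit at k. Near an interior point the restriction to
   ]0, 1] is vacuous. *)
exists (fun z => if z == k then h' k else (h z - h k) / (z - k)); split.
- move=> z; case: eqP => [->|/eqP zk]; first by rewrite !subrr mulr0.
  by rewrite divfK// subr_eq0.
- apply/cvgrPdist_lt => e e0; rewrite eqxx.
  move/cvgrPdist_lt : dh => /(_ e e0); rewrite near_withinE near_withinE => dh.
  have near01 : \forall t \near k, t \in `]0, 1[.
    by apply: near_in_itvoo; rewrite in_itv/= k0.
  near=> t; case: eqP => [_|/eqP tk]; first by rewrite subrr normr0.
  have t01 : t \in `]0, 1[ by near: t.
  have /andP[t0 t1] : 0 < t < 1 by move: t01; rewrite in_itv.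
  have := near dh t; apply => //.
  by rewrite /= in_itv/= t0 ltW.
- by rewrite eqxx.
Unshelve. all: by end_near. Qed.

Lemma C1_continuous (k : R) : 0 < k < 1 -> {for k, continuous h}.
Proof. by move=> k01; exact: is_derive_continuous (C1_is_derive k01). Qed.

Lemma C1_continuous' (k : R) : 0 < k < 1 -> {for k, continuous h'}.
Proof.
move=> k01; have [_ ch'] := h_C1.
have : {within `]0, 1[, continuous h'}.
  by apply: continuous_subspaceW ch' => t /=; rewrite !in_itv/= => /andP[-> /ltW].
rewrite continuous_open_subspace; last exact: interval_open.
by apply; rewrite inE/= in_itv.
Qed.

(** Near 1, h t is the difference quotient times t - 1, plus h 1, and the quotient converges. *)
Lemma C1_left1 : h t @[t --> 1^'-] --> h 1.
Proof.
have [/(_ 1) + _] := h_C1.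
have A1 : `]0, 1]%classic (1 : R) by rewrite /= in_itv/= ltr01 lexx.
move=> /(_ A1) dh.
have q1 : (h t - h 1) / (t - 1) @[t --> 1^'-] --> h' 1.
  move=> U HU; have := dh U HU; rewrite /= => dU.
  have {}dU : \forall t \near (1 : R)^', `]0, 1]%classic t -> U ((h t - h 1) / (t - 1)).
    by rewrite -near_withinE.
  have {}dU : \forall t \near (1 : R), t != 1 -> `]0, 1]%classic t ->
    U ((h t - h 1) / (t - 1)) by move: dU; rewrite near_withinE.
  have t0 : \forall t \near (1 : R), 0 < t by exact: lt_nbhsr.
  change (\forall t \near (1 : R)^'-, U ((h t - h 1) / (t - 1))).
  rewrite near_withinE; near=> t => t1.
  have := near dU t; apply => //; first by rewrite lt_eqF.
  rewrite /= in_itv/= (ltW t1) andbT.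
  by near: t.
have tm1 : t - 1 @[t --> 1^'-] --> (0 : R).
  rewrite -[X in _ --> X](subrr 1); apply: cvgB; last exact: cvg_cst.
  by apply: cvg_at_left_filter; exact: cvg_id.
have : (h t - h 1) / (t - 1) * (t - 1) + h 1 @[t --> 1^'-] --> h 1.
  rewrite -[X in _ --> X]add0r -[X in _ --> X + _](mulr0 (h' 1)).
  by apply: cvgD; [exact: cvgM|exact: cvg_cst].
apply: cvg_trans; apply: near_eq_cvg; rewrite near_withinE.
by apply: nearW => t t1; rewrite divfK ?subrK// subr_eq0 lt_eqF.
Unshelve. all: by end_near. Qed.

Lemma C1_left1' : h' t @[t --> 1^'-] --> h' 1.
Proof.
have [_ ch'] := h_C1.
have half1 : 2^-1 < 1 :> R by lra.
have : {within `[2^-1, 1], continuous h'}.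
  apply: continuous_subspaceW ch' => t /=; rewrite !in_itv/= => /andP[t0 ->].
  by rewrite andbT; lra.
by move/(continuous_within_itvP _ half1) => -[].
Qed.

(** Continuity up to the end point 1 opens [d, 1] to the extreme value theorem; the neighbourhood of
    0 is left to [H_small]. *)
Lemma C1_within (d : R) : 0 < d < 1 ->
  {within `[d, 1], continuous h} /\
  {within `[d, 1], continuous (fun k => k * (h' k / h k))}.
Proof.
move=> d01; have /andP[d0 d1] := d01.
have cH (k : R) : 0 < k < 1 -> {for k, continuous (fun k : R => k * (h' k / h k))}.
  move=> k01; have /andP[k0 k1] := k01.
  apply: cvgM; first exact: cvg_id.
  apply: cvgM; first exact: C1_continuous'.
  by apply: cvgV; [rewrite gt_eqF// h_gt0// k0 ltW|exact: C1_continuous].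
split; apply/(continuous_within_itvP _ d1); split.
- move=> k; rewrite in_itv/= => /andP[dk k1].
  by apply: C1_continuous; rewrite (lt_trans d0 dk).
- by apply: cvg_at_right_filter; exact: C1_continuous.
- exact: C1_left1.
- move=> k; rewrite in_itv/= => /andP[dk k1].
  by apply: cH; rewrite (lt_trans d0 dk).
- by apply: cvg_at_right_filter; exact: cH.
- apply: cvgM; first by apply: cvg_at_left_filter; exact: cvg_id.
  apply: cvgM; first exact: C1_left1'.
  by apply: cvgV; [rewrite gt_eqF// h_gt0// ltr01 lexx|exact: C1_left1].
Qed.

Lemma H_small (e : R) : 0 < e -> exists2 d : R, 0 < d < 1 &
  forall k, 0 < k <= d -> `|k * (h' k / h k)| <= e.
Proof.
move=> e0; move/cvgrPdist_lt : h_lim => /(_ e e0).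
rewrite near_withinE => /nbhs_ballP[d /= d0 dH].
exists (Num.min (d / 2) 2^-1); first by rewrite lt_min gt_min; apply/andP; split;
  [apply/andP; split; lra|apply/orP; right; lra].
move=> k /andP[k0]; rewrite le_min => /andP[kd _].
have kb : ball 0 d k by rewrite /ball/= sub0r normrN gtr0_norm//; lra.
by have := dH _ kb k0; rewrite sub0r normrN => /ltW.
Qed.

Lemma h_bounded (d : R) : 0 < d < 1 ->
  exists2 C, 0 <= C & forall k, d <= k <= 1 -> h k <= C.
Proof.
move=> d01; have /andP[d0 d1] := d01; have [ch _] := C1_within d01.
have [x xd xmax] := EVT_max (ltW d1) ch.
exists (h x); last by move=> k dk; apply: xmax; rewrite in_itv.
by move: xd; rewrite in_itv/= => /andP[dx x1]; rewrite ltW// h_gt0// x1 (lt_le_trans d0).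
Qed.

(* [k^e h(k)] has derivative [k^(e-1) h(k) (e + H(k))], hence increases near [0]. *)
Lemma h_powR_bounded (e : R) : 0 < e ->
  exists2 C, 0 <= C & forall k, 0 < k <= 1 -> k `^ e * h k <= C.
Proof.
move=> e0; have [d d01 Hd] := H_small e0; have /andP[d0 d1] := d01.
have [C C0 hC] := h_bounded d01.
have fd0 : 0 <= d `^ e * h d by rewrite mulr_ge0 ?powR_ge0// ltW// h_gt0// d0 ltW.
exists (d `^ e * h d + C); first exact: addr_ge0.
move=> k /andP[k0 k1]; have [dk|kd] := leP d k.
  apply: (@le_trans _ _ C); last by rewrite lerDr.
  apply: (@le_trans _ _ (h k)); last by rewrite hC// dk.
  by rewrite ler_piMl ?powR_le1 ?(ltW e0) ?k0// ltW// h_gt0// k0.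
apply: (@le_trans _ _ (d `^ e * h d)); last by rewrite lerDl.
pose df x := e * x `^ (e - 1) * h x + x `^ e * h' x.
have dfE (x : R) : k <= x <= d -> is_derive x 1 (fun x => x `^ e * h x) (df x).
  move=> /andP[kx xd]; have x0 : 0 < x by exact: lt_le_trans kx.
  have x01 : 0 < x < 1 by rewrite x0 (le_lt_trans xd).
  exact: is_derive_mulfun (is_derive1_powR e x0) (C1_is_derive x01).
have := @MVT _ (fun x => x `^ e * h x) df k d kd.
case.
- by move=> x; rewrite in_itv/= => /andP[/ltW kx /ltW xd]; apply: dfE; rewrite kx.
- apply: continuous_in_subspaceT => x; rewrite inE/= in_itv/= => kxd.
  exact: is_derive_continuous (dfE _ kxd).
move=> x; rewrite in_itv/= => /andP[kx xd] E.
rewrite -subr_ge0 E mulr_ge0 ?subr_ge0 ?(ltW kd)//.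
have x0 : 0 < x by exact: lt_trans kx.
have hx0 : 0 < h x by rewrite h_gt0// x0 (le_trans (ltW xd) (ltW d1)).
have xHe : `|x * (h' x / h x)| <= e by rewrite Hd// x0 ltW.
have -> : df x = x `^ (e - 1) * h x * (e + x * (h' x / h x)).
  rewrite /df powR_pred//; field; rewrite !gt_eqF//.
rewrite mulr_ge0 ?mulr_ge0 ?powR_ge0 ?(ltW hx0)//.
by move: xHe; rewrite ler_norml => /andP[]; lra.
Qed.

Lemma H_funE : H_fun h h' = fun k => k * (h' k / h k).
Proof. by apply/funext => k; rewrite /H_fun; case: eqP => // ->; rewrite mul0r. Qed.

(** [H_small] near 0, extreme values on [d, 1]. Boundedness ensures that the [inf] and [sup] in
    [H1_fun] and [max_H2] are genuine bounds and not default values. *)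
Lemma H_fun_bounded : exists B, forall k, 0 <= k <= 1 -> `|H_fun h h' k| <= B.
Proof.
have [d d01 Hd] := H_small (@ltr01 R); have /andP[d0 d1] := d01.
have [_ cH] := C1_within d01.
have [x _ xmax] := EVT_max (ltW d1) cH; have [y _ ymin] := EVT_min (ltW d1) cH.
exists (1 + `|x * (h' x / h x)| + `|y * (h' y / h y)|) => k /andP[k0 k1].
rewrite H_funE; have x0 := normr_ge0 (x * (h' x / h x)).
have y0 := normr_ge0 (y * (h' y / h y)).
move: k0; rewrite le_eqVlt => /predU1P[<-|k0]; first by rewrite mul0r normr0; lra.
have [kd|dk] := leP k d; first by have := Hd k; rewrite k0 kd => /(_ isT); lra.
have kI : k \in `[d, 1] by rewrite in_itv/= (ltW dk).
have := xmax _ kI; have := ymin _ kI.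
have := ler_norm (x * (h' x / h x)); have := ler_norm (- (y * (h' y / h y))).
rewrite normrN => *; rewrite ler_norml; apply/andP; split; lra.
Qed.

Let H1_lbound k : 0 <= k <= 1 ->
  has_lbound [set H_fun h h' t | t in `[0, k]].
Proof.
move=> /andP[k0 k1]; have [B HB] := H_fun_bounded.
exists (- B) => _ [t /= + <-]; rewrite in_itv/= => /andP[t0 tk].
by have := HB t; rewrite t0 (le_trans tk k1) => /(_ isT); rewrite ler_norml => /andP[].
Qed.

Lemma H1_fun_le k t : 0 <= t -> t <= k -> k <= 1 -> H1_fun h h' k <= H_fun h h' t.
Proof.
move=> t0 tk k1; apply: ge_inf.
  by apply: H1_lbound; rewrite (le_trans t0 tk).
by exists t => //=; rewrite in_itv/= t0.
Qed.

(** The infimum runs over a set containing t = 0, where H vanishes by definition. *)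
Lemma H1_fun_le0 k : 0 <= k <= 1 -> H1_fun h h' k <= 0.
Proof.
move=> /andP[k0 k1]; have := H1_fun_le (lexx 0) k0 k1.
by rewrite /H_fun eqxx.
Qed.

Lemma H1_fun_noninc k l : 0 <= k -> k <= l -> l <= 1 ->
  H1_fun h h' l <= H1_fun h h' k.
Proof.
move=> k0 kl l1; apply: lb_le_inf.
  by exists (H_fun h h' 0); exists 0 => //=; rewrite in_itv/= lexx.
move=> _ [t /= + <-]; rewrite in_itv/= => /andP[t0 tk].
by apply: H1_fun_le => //; exact: le_trans tk kl.
Qed.

Lemma H2_fun_ge0_le_max k : 0 <= k <= 1 -> 0 <= H2_fun h h' k <= max_H2 h h'.
Proof.
move=> /andP[k0 k1]; rewrite /H2_fun subr_ge0 H1_fun_le//=.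
have [B HB] := H_fun_bounded.
apply: ub_le_sup; last by exists k => //=; rewrite in_itv/= k0.
exists (B - H1_fun h h' 1) => _ [t /= + <-]; rewrite in_itv/= => /andP[t0 t1].
apply: lerB; last exact: H1_fun_noninc.
by apply: le_trans (ler_norm _) (HB _ _); rewrite t0.
Qed.

End slowly_varying_factor.

(** * Minimaxity *)

Section marginal_weight.
Context {R : realType}.
Local Notation mu := (@lebesgue_measure R).
Local Notation I01 := (`]0%R, 1%R[%classic : set R).
Variables (b c : R) (h h' : R -> R).
Hypothesis b01 : 0 < b < 1.
Hypothesis c_ge0 : 0 <= c.
Hypothesis h_gt0 : forall k, 0 < k <= 1 -> 0 < h k.
Hypothesis h_C1 : C1_on `]0, 1] h h'.
Hypothesis h_lim : k * (h' k / h k) @[k --> 0^'+] --> (0 : R).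
Hypothesis int0 : c = 0 -> (\int[mu]_(k in I01) (k^-1 * h k)%:E < +oo)%E.

(** The prior times k^(p/2), with c = p/2 + a. Its integrability makes the estimator well defined
    for improper priors as well. *)
Definition marginal_weight (k : R) := k `^ (c - 1) * (1 - k) `^ (b - 1) * h k.
Local Notation phi := marginal_weight.

Let half01 : 0 < (2^-1 : R) < 1.
Proof. by rewrite invr_gt0 ltr0n/= invf_lt1 ?ltr0n// ltr1n. Qed.

Lemma marginal_weight_gt0 k : I01 k -> 0 < phi k.
Proof.
rewrite /= in_itv/= => /andP[k0 k1].
by rewrite !mulr_gt0 ?powR_gt0 ?subr_gt0// h_gt0// k0 ltW.
Qed.

Lemma is_derive_marginal_weight (k : R) : I01 k -> is_derive k 1 phi
  (phi k * ((c - 1 + H_fun h h' k) / k + (1 - b) / (1 - k))).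
Proof.
rewrite /= in_itv/= => /andP[k0 k1].
have k01 : 0 < k < 1 by rewrite k0.
have hk : 0 < h k by rewrite h_gt0// k0 ltW.
have k1' : 0 < 1 - k by rewrite subr_gt0.
have := is_derive_mulfun (is_derive_mulfun (is_derive1_powR (c - 1) k0)
  (is_derive_powR_onem (b - 1) k1)) (C1_is_derive h_C1 k01).
move/is_derive_eq; apply; rewrite H_funE /marginal_weight !powR_pred//.
by field; rewrite !gt_eqF.
Qed.

Let powR_c_half (k : R) : 2^-1 <= k <= 1 -> k `^ (c - 1) <= 2.
Proof.
have /andP[h0 _] := half01; move=> /andP[kh k1].
have k0 : 0 < k by exact: lt_le_trans kh.
rewrite powR_pred// ler_pdivrMr//; apply: (@le_trans _ _ 1).
  by rewrite powR_le1// k0.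
by rewrite -ler_pdivrMl ?ltr0n// mulr1.
Qed.

Let powR_b_half (k : R) : 0 < k <= 2^-1 -> (1 - k) `^ (b - 1) <= 2.
Proof.
have /andP[b0 b1] := b01; move=> /andP[k0 kh].
apply: (@le_trans _ _ ((2^-1 : R) `^ (b - 1))).
  by apply: powR_noninc; lra.
have /andP[h0 h1] := half01.
apply: (@le_trans _ _ ((2^-1 : R) `^ (- 1))); last by rewrite powR_inv1 ?invrK// ltW.
by apply: ger_powR; [rewrite h0 ltW|lra].
Qed.

(** For c > 0 half of the exponent bounds h: k^(c/2) h(k) is bounded and k^(c/2 - 1) integrable. For
    c = 0 this is the hypothesis on h. *)
Lemma integrable_powR_h : mu.-integrable I01 (EFin \o (fun k => k `^ (c - 1) * h k)).
Proof.
have mh : measurable_fun I01 h.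
  apply: open_continuous_measurable_fun; first exact: interval_open.
  move=> k; rewrite inE/= in_itv/= => /andP[k0 k1].
  by apply: (C1_continuous h_C1); rewrite k0.
have mpow r : measurable_fun I01 (fun k : R => k `^ r).
  apply: open_continuous_measurable_fun; first exact: interval_open.
  by move=> k; rewrite inE/= in_itv/= => /andP[k0 _]; exact: continuous_powR_gt0.
have mf : measurable_fun I01 (EFin \o (fun k => k `^ (c - 1) * h k)).
  by apply/measurable_EFinP; exact: measurable_funM.
move: c_ge0; rewrite le_eqVlt => /predU1P[c0|c0].
  apply/integrableP; split => //.
  rewrite (_ : integral _ _ _ = \int[mu]_(k in I01) (k^-1 * h k)%:E)%E.
    exact: int0.
  apply: eq_integral => k; rewrite inE/= in_itv/= => /andP[k0 k1].
  rewrite -c0 sub0r powR_inv1 ?(ltW k0)// ger0_norm// mulr_ge0 ?invr_ge0 ?(ltW k0)//.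
  by rewrite ltW// h_gt0// k0 ltW.
have c20 : 0 < c / 2 by rewrite divr_gt0.
have [C C0 hC] := h_powR_bounded h_gt0 h_C1 h_lim c20.
apply: (@le_integrable _ _ _ mu _ (measurable_itv _) _
  (fun k => C%:E * (k `^ (c / 2 - 1))%:E)%E) => //; last first.
  by apply: integrableZl; [exact: measurable_itv|exact: integrable_powR].
move=> k; rewrite /= in_itv/= => /andP[k0 k1]; rewrite lee_fin.
have k01 : 0 < k <= 1 by rewrite k0 ltW.
have p0 : 0 <= k `^ (c / 2 - 1) by exact: powR_ge0.
rewrite ger0_norm; last by rewrite mulr_ge0 ?powR_ge0// ltW// h_gt0.
rewrite ger0_norm ?mulr_ge0//.
have -> : k `^ (c - 1) = k `^ (c / 2) * k `^ (c / 2 - 1).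
  rewrite -powRD; last by rewrite (gt_eqF k0) implybT.
  by congr (_ `^ _); field.
by rewrite mulrAC ler_wpM2r// hC.
Qed.

(** Only one factor is singular on each side of 1/2. There the regular power is at most 2, and h <=
    C on the right half, so a sum of two integrable functions dominates phi. *)
Lemma integrable_marginal_weight : mu.-integrable I01 (EFin \o phi).
Proof.
have /andP[b0 b1] := b01; have /andP[h0 h1] := half01.
have [C C0 hC] := h_bounded h_gt0 h_C1 half01.
have mphi : measurable_fun I01 (EFin \o phi).
  apply/measurable_EFinP; apply: open_continuous_measurable_fun.
    exact: interval_open.
  move=> k; rewrite inE => k01.
  exact: is_derive_continuous (is_derive_marginal_weight k01).
apply: (@le_integrable _ _ _ mu _ (measurable_itv _) _
  (fun k => 2%:E * (k `^ (c - 1) * h k)%:E + (2 * C)%:E * ((1 - k) `^ (b - 1))%:E)%E)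
  => //; last first.
  apply: integrableD; first exact: measurable_itv.
    by apply: integrableZl; [exact: measurable_itv|exact: integrable_powR_h].
  by apply: integrableZl; [exact: measurable_itv|exact: integrable_powR_onem].
move=> k k01; have p0 := marginal_weight_gt0 k01.
move: k01; rewrite /= in_itv/= => /andP[k0 k1]; rewrite lee_fin gtr0_norm//.
have hk0 : 0 < h k by rewrite h_gt0// k0 ltW.
have A0 : 0 <= k `^ (c - 1) * h k by rewrite mulr_ge0 ?powR_ge0// ltW.
have B0 : 0 <= (1 - k) `^ (b - 1) by exact: powR_ge0.
have CB0 : 0 <= 2 * C * (1 - k) `^ (b - 1) by rewrite !mulr_ge0.
rewrite ger0_norm; last by rewrite addr_ge0// mulr_ge0.
rewrite /marginal_weight mulrAC; have [kh|hk] := leP k 2^-1.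
  apply: (@le_trans _ _ (2 * (k `^ (c - 1) * h k))); last by rewrite lerDl.
  by rewrite mulrC ler_wpM2r// powR_b_half// k0.
apply: (@le_trans _ _ (2 * C * (1 - k) `^ (b - 1))); last first.
  by rewrite lerDr mulr_ge0.
apply: ler_wpM2r => //; apply: ler_pM; rewrite ?powR_ge0 ?(ltW hk0)//.
  by rewrite powR_c_half// !ltW.
by rewrite hC// !ltW.
Qed.

Let x01 (n : nat) : 0 < (n.+3%:R^-1 : R) <= 2^-1.
Proof. by rewrite invr_gt0 ltr0n/= lef_pV2 ?posrE ?ltr0n// ler_nat. Qed.

(** x^2 phi(x) contains x^c, x^(1/2) h(x) and a spare x^(1/2): the first two are bounded even if h
    is unbounded at 0, and the third tends to 0. *)
Lemma marginal_weight_at0 :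
  phi n.+3%:R^-1 * n.+3%:R^-1 ^+ 2 @[n --> \oo] --> (0 : R).
Proof.
have /andP[h0 h1] := half01.
have [C C0 hC] := h_powR_bounded h_gt0 h_C1 h_lim h0.
apply: (@squeeze_cvgr _ _ _ _ (cst 0) (fun n => 2 * C * n.+3%:R^-1 `^ 2^-1)).
- apply: nearW => n; have /andP[x0 xh] := x01 n; move: (n.+3%:R^-1) x0 xh => x x0 xh.
  have x1 : x < 1 by exact: le_lt_trans h1.
  have xx : 0 < x <= 1 by rewrite x0 ltW.
  have hx0 := h_gt0 xx.
  have Hx := hC _ xx; have Px := powR_ge0 x 2^-1; have Bx := powR_ge0 (1 - x) (b - 1).
  have Bx2 : (1 - x) `^ (b - 1) <= 2 by rewrite powR_b_half// x0.
  have Cx : x `^ c <= 1 by rewrite powR_le1.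
  have Cx0 := powR_ge0 x c.
  have xsq : x = x `^ 2^-1 * x `^ 2^-1.
    rewrite -powRD; last by rewrite (gt_eqF x0) implybT.
    by rewrite -[LHS]powRr1 ?(ltW x0)//; congr (_ `^ _); field.
  apply/andP; split.
    by rewrite mulr_ge0 ?sqr_ge0// ltW// marginal_weight_gt0//= in_itv/= x0.
  rewrite /marginal_weight powR_pred//.
  rewrite (_ : _ * _ = x `^ c * (1 - x) `^ (b - 1) * (h x * x)); last first.
    by field; rewrite gt_eqF.
  rewrite {4}xsq (_ : _ * _ = x `^ c * ((1 - x) `^ (b - 1) * (x `^ 2^-1 * h x)) *
    x `^ 2^-1); last by ring.
  apply: ler_wpM2r => //.
  have D0 : 0 <= (1 - x) `^ (b - 1) * (x `^ 2^-1 * h x).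
    by rewrite !mulr_ge0// ltW.
  apply: (@le_trans _ _ ((1 - x) `^ (b - 1) * (x `^ 2^-1 * h x))).
    by rewrite ler_piMl.
  by apply: ler_pM => //; rewrite mulr_ge0// ltW.
- exact: cvg_cst.
- rewrite -[X in _ --> X](mulr0 (2 * C)); apply: cvgMr; exact: cvg_powR_invn.
Qed.

(** The factor x raises the singular x^(b-1) to x^b, which tends to 0 because b > 0. *)
Lemma marginal_weight_at1 :
  phi (1 - n.+3%:R^-1) * n.+3%:R^-1 @[n --> \oo] --> (0 : R).
Proof.
have /andP[b0 b1] := b01.
have [C C0 hC] := h_bounded h_gt0 h_C1 half01.
apply: (@squeeze_cvgr _ _ _ _ (cst 0) (fun n => 2 * C * n.+3%:R^-1 `^ b)).
- apply: nearW => n; have /andP[x0 xh] := x01 n; move: (n.+3%:R^-1) x0 xh => x x0 xh.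
  have /andP[h0 h1] := half01.
  have y01 : 2^-1 <= 1 - x <= 1 by apply/andP; split; lra.
  have y0 : 0 < 1 - x < 1 by apply/andP; split; lra.
  have hy : 0 < h (1 - x) by apply: h_gt0; apply/andP; split; lra.
  apply/andP; split.
    by rewrite mulr_ge0 ?(ltW x0)// ltW// marginal_weight_gt0//= in_itv/=.
  rewrite /marginal_weight subKr (powR_pred b x0).
  rewrite (_ : _ * _ = (1 - x) `^ (c - 1) * h (1 - x) * x `^ b); last first.
    by field; rewrite gt_eqF.
  apply: ler_wpM2r; first exact: powR_ge0.
  by apply: ler_pM; rewrite ?powR_ge0 ?(ltW hy) ?powR_c_half ?hC.
- exact: cvg_cst.
- rewrite -[X in _ --> X](mulr0 (2 * C)); apply: cvgMr; exact: cvg_powR_invn.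
Qed.

End marginal_weight.

Lemma kappa_moment_wmoment (R : realType) (a b q s : R) (h : R -> R) (j : nat) :
  kappa_moment (prior_density a b h) (q + j%:R) s =
  wmoment (marginal_weight b (q + a) h) j s.
Proof.
apply: eq_Rintegral => k; rewrite inE/= in_itv/= => /andP[k0 k1].
have knz (t : R) : (t == 0) ==> (k != 0) by rewrite (gt_eqF k0) implybT.
rewrite /prior_density /marginal_weight (@powRD _ _ q) ?knz//.
rewrite -[q + a - 1]addrA (@powRD _ _ q) ?knz// powR_mulrn ?(ltW k0)//.
by rewrite (_ : s / 2 * k = k * s / 2); [ring|field].
Qed.

Lemma bayes_estimator_shrink (R : realType) (p : nat) (a b : R) (h : R -> R) :
  bayes_estimator (p := p) (prior_density a b h) =
  shrink (wratio (marginal_weight b (p%:R / 2 + a) h)).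
Proof.
apply/funext => y; apply: eq_from_tnth => i; rewrite !tnth_mktuple.
rewrite /wratio -!kappa_moment_wmoment addr0.
by [].
Qed.

Theorem theorem3p1 (R : realType) (p : nat) (a b : R) (h h' : R -> R)
  (p_gt0 : (0 < p)%N)
  (a_lt1 : a < 1)
  (b_gt0 : 0 < b) (b_lt1 : b < 1)
  (h_gt0 : forall k, 0 < k <= 1 -> 0 < h k)
  (h_C1 : C1_on `]0, 1] h h')
  (h_slow : slowly_varying0 h)
  (h_lim : k * (h' k / h k) @[k --> 0^'+] --> (0 : R))
  (a_int : - (p%:R / 2) < a \/
    a = - (p%:R / 2) /\
    (\int[lebesgue_measure]_(k in `]0%R, 1%R[) (k^-1 * h k)%:E < +oo)%E)
  (a_ge : - (p%:R / 2) <= a)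
  (a_lt : a < p%:R / 2 - 2)
  (cond : 3 * p%:R / 2 + a - (p%:R + 2 * a + 2 + 2 * max_H2 h h') / b
          + Num.min 0 (p%:R / 2 + a + 2 + H1_fun h h' 1) >= 0) :
  minimax (bayes_estimator (p := p) (prior_density a b h)).
Proof.
pose c := p%:R / 2 + a.
pose phi := marginal_weight b c h.
have b01 : 0 < b < 1 by rewrite b_gt0.
have c0 : 0 <= c by rewrite /c; lra.
have int0 : c = 0 ->
    (\int[lebesgue_measure]_(k in `]0%R, 1%R[) (k^-1 * h k)%:E < +oo)%E.
  by case: a_int => [ap|[]//] c00; exfalso; move: c00; rewrite /c; lra.
have phi_gt0 := marginal_weight_gt0 b c h_gt0.
have int_phi := integrable_marginal_weight b01 c0 h_gt0 h_C1 h_lim int0.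
have dphi := is_derive_marginal_weight b c h_gt0 h_C1.
have at0 := marginal_weight_at0 b01 c0 h_gt0 h_C1 h_lim.
have at1 := marginal_weight_at1 b01 c0 h_gt0 h_C1.
have cH k : `]0%R, 1%R[%classic k -> {for k, continuous (H_fun h h')}.
  rewrite /= in_itv/= => k01; have /andP[k0 k1] := k01; rewrite H_funE.
  apply: cvgM; first exact: cvg_id.
  apply: cvgM; first exact: (C1_continuous' h_C1).
  by apply: cvgV; [rewrite gt_eqF// h_gt0// k0 ltW|exact: (C1_continuous h_C1)].
have bmH : bounded_measurable (H_fun h h').
  have [B HB] := H_fun_bounded h_gt0 h_C1 h_lim.
  apply: (bounded_measurable_continuous cH (C := B)) => k.
  by rewrite /= in_itv/= => /andP[k0 k1]; rewrite HB// !ltW.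
(* [nondecreasing_measurable] wants a function monotone on the whole line. *)
pose clamp (k : R) := Num.min 1 (Num.max 0 k).
have clamp01 k : 0 <= clamp k <= 1.
  by rewrite /clamp le_min ler01 le_max lexx ge_min lexx.
have clampE k : 0 <= k <= 1 -> clamp k = k.
  by move=> /andP[k0 k1]; rewrite /clamp max_r// min_r.
(* On [0, 1] this is -H_1, nonnegative and nondecreasing, and H + g = H_2. *)
pose g k := - H1_fun h h' (clamp k).
have ng k l : k <= l -> g k <= g l.
  move=> kl; have /andP[k0 k1] := clamp01 k; have /andP[l0 l1] := clamp01 l.
  rewrite lerN2 (H1_fun_noninc h_gt0 h_C1 h_lim)//.
  by rewrite /clamp le_min2// le_max2.
have gE k : 0 <= k <= 1 -> g k = - H1_fun h h' k by move=> k01; rewrite /g clampE.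
have g01 k : 0 <= g k <= - H1_fun h h' 1.
  have /andP[k0 k1] := clamp01 k.
  rewrite /g oppr_ge0 (H1_fun_le0 h_gt0 h_C1 h_lim)//= lerN2.
  exact: (H1_fun_noninc h_gt0 h_C1 h_lim).
have bg : bounded_measurable g.
  split; first by apply: nondecreasing_measurable => //; exact: measurable_itv.
  by exists (- H1_fun h h' 1) => k _; have /andP[g0 g1] := g01 k; rewrite ger0_norm.
have Hg k : `]0%R, 1%R[%classic k -> 0 <= H_fun h h' k + g k <= max_H2 h h'.
  rewrite /= in_itv/= => /andP[k0 k1]; have k01 : 0 <= k <= 1 by rewrite !ltW.
  by rewrite gE//; exact: (H2_fun_ge0_le_max h_gt0 h_C1 h_lim).
have m0 : 0 <= max_H2 h h'.
  have /andP[u v] := H2_fun_ge0_le_max h_gt0 h_C1 h_lim (k := 0)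
    (andb_true_intro (conj (lexx 0) ler01)).
  exact: le_trans u v.
have cp : c < p%:R - 2 by rewrite /c; lra.
(* The hypothesis rewritten through c = p/2 + a: 3p/2 + a = p + c and p + 2a + 2 = 2c + 2, with G1 =
   -H_1(1). *)
have cond' : 0 <= p%:R + c - (2 * c + 2 + 2 * max_H2 h h') / b +
    Num.min 0 (c + 2 - - H1_fun h h' 1).
  rewrite opprK; move: cond; rewrite /c.
  rewrite (_ : 2 * (p%:R / 2 + a) + 2 + 2 * max_H2 h h' =
    p%:R + 2 * a + 2 + 2 * max_H2 h h'); last by field.
  by rewrite (_ : p%:R + (p%:R / 2 + a) = 3 * p%:R / 2 + a)//; field.
have ineq := wratio_differential_inequality phi_gt0 int_phi b01 bmH cH dphi at0 at1
  bg (fun k l _ kl _ => ng k l kl) (fun k _ => g01 k) Hg c0 m0 cp cond'.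
have dr := is_derive_wratio phi_gt0 int_phi.
have cr' := continuous_wratio' phi_gt0 int_phi.
have cr : continuous (wratio phi) by move=> s; exact: is_derive_continuous (dr s).
(* The risk is at most p everywhere, and p is at most the maximal risk of any competitor. *)
rewrite bayes_estimator_shrink; split; first exact: measurable_shrink.
move=> delta mdelta; apply: le_trans (sup_risk_ge mdelta).
apply: ge_ereal_sup => _ [beta _ <-].
exact: (risk_shrink_le beta dr cr' (wratio_ge0_le1 phi_gt0 int_phi)
  (wratio'_geN1_le0 phi_gt0 int_phi) ineq).
Qed.
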